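(* Let $p$ be a prime, $G$ a finite group of order $p$, and let $X=\{X_i\}_{i\in I}$ be a pro-object of the category of topological spaces, indexed by a small filtering index category, which is cohomologically acyclic mod $p$. Let $h=\{h_i\}_{i\in I}$ be a continuous left action of $G$ on $X$ such that each $X_i$ is a finite $G$-CW complex with respect to $h_i$, and assume there is a natural number $N$ such that no $X_i$ has cells of dimension bigger than $N$. Then the pro-object $X^G=\{X_i^G\}_{i\in I}$ of fixed points is cohomologically acyclic mod $p$.
   Context: All topological spaces are Hausdorff. A pro-object $X=\{X_i\}_{i\in I}$ is given by a functor $\mathbf X:\mathcal I^{\mathrm{op}}\to(\text{topological spaces})$ for a small filtering category $\mathcal I$ with object set $I$, $X_i=\mathbf X(i)$. For an abelian group $A$ set $H^k(X,A)=\varinjlim_{i\in I}H^k(X_i,A)$ and $H^k(X)=H^k(X,\mathbb F_p)$. $X$ is cohomologically acyclic mod $p$ if $H^0(X)=\mathbb F_p$ and $H^k(X)=0$ for all $k>0$. A continuous left action of $G$ on $X$ is a family of continuous left actions $h_i$ of $G$ on $X_i$ such that every transition map $\mathbf X(\phi):X_i\to X_j$ is $G$-equivariant; $X_i^G$ denotes the fixed-point set of $h_i$, and the transition maps restrict to give the pro-object $X^G=\{X_i^G\}_{i\in I}$. *)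

(* Defs.v *)
From HB Require Import structures.
From mathcomp Require Import all_boot all_order all_algebra all_fingroup.
From mathcomp Require Import generic_quotient ring_quotient.
From mathcomp Require Import all_classical all_reals all_analysis.

Set Implicit Arguments.
Unset Strict Implicit.
Unset Printing Implicit Defensive.

Import Order.TTheory GRing.Theory Num.Theory.
Import numFieldNormedType.Exports.

Local Open Scope classical_set_scope.
Local Open Scope ring_scope.
Local Open Scope quotient_scope.

Record category := Category {
  obj :> Type;
  hom : obj -> obj -> Type;
  idm : forall i, hom i i;
  comp : forall i j k, hom j k -> hom i j -> hom i k;
  comp_idl : forall i j (u : hom i j), comp (idm j) u = u;
  comp_idr : forall i j (u : hom i j), comp u (idm i) = u;
  comp_assoc : forall i j k l (w : hom k l) (v : hom j k) (u : hom i j),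
    comp w (comp v u) = comp (comp w v) u }.
Arguments hom {c}.
Arguments idm {c}.
Arguments comp {c i j k}.

Definition filtering (C : category) : Prop :=
  [/\ inhabited C,
      forall i j : C, exists k : C, inhabited (hom i k) /\ inhabited (hom j k)
    & forall (i j : C) (u v : hom i j),
        exists (k : C) (w : hom j k), comp w u = comp w v].

Record filtering_category := FilteringCategory {
  filtering_cat :> category;
  filteringP : filtering filtering_cat }.

Record direct_system (C : category) := DirectSystem {
  ds_obj :> C -> zmodType;
  ds_map : forall i j, hom i j -> {additive ds_obj i -> ds_obj j};
  ds_map_id : forall i x, ds_map (idm i) x = x;
  ds_map_comp : forall i j k (v : hom j k) (u : hom i j) x,
    ds_map (comp v u) x = ds_map v (ds_map u x) }.
Arguments ds_map {C} d {i j}.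
Arguments ds_map_comp {C} d {i j k}.
Arguments ds_map_id {C} d i.

Section DirectLimit.
Variables (I : filtering_category) (D : direct_system I).

Definition germ := {i : I & D i}.
HB.instance Definition _ := gen_eqMixin germ.
HB.instance Definition _ := gen_choiceMixin germ.

Definition Germ i (x : D i) : germ := existT _ i x.

Definition germ_eq (s t : germ) : bool :=
  `[< exists (k : I) (u : hom (projT1 s) k) (v : hom (projT1 t) k),
        ds_map D u (projT2 s) = ds_map D v (projT2 t) >].

Lemma upper_bound (i j : I) : {k : I & (hom i k * hom j k)%type}.
Proof.
have [_ /(_ i j) /cid[k [iu iv]] _] := filteringP I.
have [|u _] := @cid _ (fun _ : hom i k => True); first by case: iu => u; exists u.
have [|v _] := @cid _ (fun _ : hom j k => True); first by case: iv => v; exists v.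
by exists k; split.
Qed.

Lemma germ_eq_equiv : equiv_class_of germ_eq.
Proof.
split.
- by move=> s; apply/asboolP; exists (projT1 s), (idm _), (idm _).
- move=> s t; apply/asboolP/asboolP => -[k [u [v e]]];
    by exists k, v, u.
- move=> t s r /asboolP[k [u [v e]]] /asboolP[l [w [z f]]]; apply/asboolP.
  have [m [a b]] := upper_bound k l.
  have [_ _ /(_ _ _ (comp a v) (comp b w))[n [c ec]]] := filteringP I.
  exists n, (comp c (comp a u)), (comp c (comp b z)).
  rewrite !ds_map_comp e -f -(ds_map_comp D a) -(ds_map_comp D c) ec.
  by rewrite !ds_map_comp.
Qed.

Canonical germ_eq_equiv_rel := EquivRelPack germ_eq_equiv.
Canonical germ_eq_encModRel := defaultEncModRel germ_eq.

Definition dirlim := {eq_quot germ_eq}.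
HB.instance Definition _ := EqQuotient.on dirlim.
HB.instance Definition _ := Choice.on dirlim.

Definition dirlim_in i (x : D i) : dirlim := \pi_dirlim (Germ x).

Lemma dirlim_inP i j (x : D i) (y : D j) :
  dirlim_in x = dirlim_in y <->
  exists (k : I) (u : hom i k) (v : hom j k), ds_map D u x = ds_map D v y.
Proof.
rewrite /dirlim_in; split.
  by move=> /eqP; rewrite piE => /asboolP.
by move=> h; apply/eqP; rewrite piE; apply/asboolP.
Qed.

Lemma dirlim_in_map i j (u : hom i j) (x : D i) :
  dirlim_in (ds_map D u x) = dirlim_in x.
Proof.
apply/dirlim_inP; exists j, (idm j), u.
by rewrite ds_map_id.
Qed.

Lemma dirlim_in_surj (a : dirlim) : exists i (x : D i), a = dirlim_in x.
Proof.
exists (projT1 (repr a)), (projT2 (repr a)).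
rewrite /dirlim_in /Germ; case E: (repr a) => [i x] /=.
by rewrite -E reprK.
Qed.

Definition dirlim_base : I := sval (@cid I (fun=> True)
  (let: And3 (inhabits i) _ _ := filteringP I in ex_intro _ i Logic.I)).

Definition dirlim_zero : dirlim := dirlim_in (0 : D dirlim_base).

Definition dirlim_opp (a : dirlim) : dirlim := dirlim_in (- projT2 (repr a)).

Definition dirlim_add (a b : dirlim) : dirlim :=
  let: existT k (u, v) := upper_bound (projT1 (repr a)) (projT1 (repr b)) in
  dirlim_in (ds_map D u (projT2 (repr a)) + ds_map D v (projT2 (repr b))).

Lemma repr_dirlim_in i (x : D i) :
  dirlim_in (projT2 (repr (dirlim_in x))) = dirlim_in x.
Proof.
rewrite -[RHS]reprK {1}/dirlim_in /Germ.
by congr \pi; case: (repr _).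
Qed.

Lemma dirlim_zeroE i : dirlim_zero = dirlim_in (0 : D i).
Proof.
have [k [u v]] := upper_bound dirlim_base i.
by apply/dirlim_inP; exists k, u, v; rewrite !raddf0.
Qed.

Lemma dirlim_oppE i (x : D i) : dirlim_opp (dirlim_in x) = dirlim_in (- x).
Proof.
rewrite /dirlim_opp; have /dirlim_inP[k [u [v e]]] := repr_dirlim_in x.
by apply/dirlim_inP; exists k, u, v; rewrite !raddfN e.
Qed.

Lemma dirlim_addE i (x y : D i) :
  dirlim_add (dirlim_in x) (dirlim_in y) = dirlim_in (x + y).
Proof.
rewrite /dirlim_add; move: (repr_dirlim_in x) (repr_dirlim_in y).
case: (repr (dirlim_in x)) => i' x'; case: (repr (dirlim_in y)) => j y' /=.
case: upper_bound => k [u v].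
move=> /dirlim_inP[m [c [d f]]] /dirlim_inP[l [a [b e]]].
have [n1 [p1 q1]] := upper_bound k l; have [n2 [p2 q2]] := upper_bound n1 m.
have [_ _ eqz] := filteringP I.
have [n3 [w3 e3]] := eqz _ _ (comp p2 (comp p1 u)) (comp q2 c).
have [n4 [w4 e4]] := eqz _ _ (comp w3 (comp p2 (comp p1 v)))
  (comp w3 (comp p2 (comp q1 a))).
have [n5 [w5 e5]] := eqz _ _ (comp w4 (comp w3 (comp p2 (comp q1 b))))
  (comp w4 (comp w3 (comp q2 d))).
apply/dirlim_inP; exists n5, (comp w5 (comp w4 (comp w3 (comp p2 p1)))),
  (comp w5 (comp w4 (comp w3 (comp q2 d)))).
have {}e3 z : ds_map D w3 (ds_map D p2 (ds_map D p1 (ds_map D u z))) =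
    ds_map D w3 (ds_map D q2 (ds_map D c z)) by rewrite -!ds_map_comp -!comp_assoc e3.
have {}e4 z : ds_map D w4 (ds_map D w3 (ds_map D p2 (ds_map D p1 (ds_map D v z))))
    = ds_map D w4 (ds_map D w3 (ds_map D p2 (ds_map D q1 (ds_map D a z)))).
  by rewrite -!ds_map_comp -!comp_assoc e4.
have {}e5 z : ds_map D w5 (ds_map D w4 (ds_map D w3 (ds_map D p2 (ds_map D q1
      (ds_map D b z)))))
    = ds_map D w5 (ds_map D w4 (ds_map D w3 (ds_map D q2 (ds_map D d z)))).
  by rewrite -!ds_map_comp -!comp_assoc e5.
by rewrite !raddfD /= !ds_map_comp e3 e4 f e e5.
Qed.

Lemma dirlim_addA : associative dirlim_add.
Proof.
move=> a b c.
have [i [x ->]] := dirlim_in_surj a; have [j [y ->]] := dirlim_in_surj b.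
have [k [z ->]] := dirlim_in_surj c.
have [m [u v]] := upper_bound i j; have [n [w s]] := upper_bound m k.
rewrite -(dirlim_in_map (comp w u)) -(dirlim_in_map (comp w v) y).
by rewrite -(dirlim_in_map s) !dirlim_addE addrA.
Qed.

Lemma dirlim_addC : commutative dirlim_add.
Proof.
move=> a b.
have [i [x ->]] := dirlim_in_surj a; have [j [y ->]] := dirlim_in_surj b.
have [m [u v]] := upper_bound i j.
by rewrite -(dirlim_in_map u) -(dirlim_in_map v y) !dirlim_addE addrC.
Qed.

Lemma dirlim_add0 : left_id dirlim_zero dirlim_add.
Proof.
move=> a; have [i [x ->]] := dirlim_in_surj a.
by rewrite (dirlim_zeroE i) dirlim_addE add0r.
Qed.

Lemma dirlim_addN : left_inverse dirlim_zero dirlim_opp dirlim_add.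
Proof.
move=> a; have [i [x ->]] := dirlim_in_surj a.
by rewrite dirlim_oppE dirlim_addE addNr -dirlim_zeroE.
Qed.

HB.instance Definition _ := GRing.isZmodule.Build dirlim
  dirlim_addA dirlim_addC dirlim_add0 dirlim_addN.

End DirectLimit.

Section Simplex.
Variable R : realType.

Definition std_simplex k : set 'rV[R]_k.+1 :=
  [set x | (forall j, 0 <= x ord0 j) /\ \sum_j x ord0 j = 1].
Arguments std_simplex : clear implicits.

Definition insert_zero k (i : 'I_k.+2) (x : 'rV[R]_k.+1) : 'rV[R]_k.+2 :=
  \row_j oapp (x ord0) 0 (unlift i j).

Lemma insert_zero_simplex k (i : 'I_k.+2) (x : std_simplex k) :
  insert_zero i (val x) \in std_simplex k.+1.
Proof.
have [x0 x1] := set_mem (valP x); apply/mem_set; split.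
  by move=> j; rewrite mxE; case: unliftP => [j' _|_] //=; exact: x0.
rewrite (bigD1_ord i) //= mxE unlift_none /= add0r -[RHS]x1.
by apply: eq_bigr => j _; rewrite mxE liftK.
Qed.

Definition face_fun k (i : 'I_k.+2) (x : std_simplex k) : std_simplex k.+1 :=
  exist _ (insert_zero i (val x)) (insert_zero_simplex i x).

Lemma face_fun_continuous k (i : 'I_k.+2) : continuous (face_fun i).
Proof.
apply: continuous_comp_initial => x.
have -> : set_val \o face_fun i = insert_zero i \o set_val by [].
apply: continuous_comp.
  exact: initial_continuous.
move=> A [P nP sPA].
exists (fun a b => if a == ord0 then P ord0 (lift i b) else setT).
  move=> a b; case: eqP => [->|_]; last exact: filterT.
  by have := nP ord0 (lift i b); rewrite mxE liftK.
move=> N PN; apply: sPA => a b; rewrite (ord1 a) mxE.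
case: (unliftP i b) => [c ->|->] /=; first by have := PN ord0 c.
by apply: nbhs_singleton; have := nP ord0 i; rewrite mxE unlift_none.
Qed.

Definition face k (i : 'I_k.+2) : continuousType (std_simplex k) (std_simplex k.+1) :=
  mkcts (@face_fun_continuous k i).

End Simplex.
Arguments std_simplex : clear implicits.
Arguments face R {k} i.

Section Cochains.
Variables (R : realType) (X : topologicalType) (A : zmodType).

Definition singular_simplex k := continuousType (std_simplex R k) X.

Definition cochain k := singular_simplex k -> A.
HB.instance Definition _ k := GRing.Zmodule.on (cochain k).

Definition coboundary k (c : cochain k) : cochain k.+1 :=
  fun s => \sum_(i < k.+2) c (s \o face R i) *~ (-1) ^+ i.

Lemma coboundary_is_zmod_morphism k : zmod_morphism (@coboundary k).
Proof.
move=> c d; apply/funext => s.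
transitivity (coboundary c s - coboundary d s) => //.
by rewrite /coboundary -sumrB; apply: eq_bigr => i _; rewrite -mulrzBl.
Qed.
HB.instance Definition _ k := GRing.isZmodMorphism.Build _ _ (@coboundary k)
  (@coboundary_is_zmod_morphism k).

Definition cocycle k : {pred cochain k} := [pred c | coboundary c == 0].

Lemma cocycleP k (c : cochain k) :
  reflect (coboundary c = 0) (c \in @cocycle k).
Proof. exact: (@eqP _ (coboundary c) 0). Qed.

Lemma cocycle_closed k : zmod_closed (@cocycle k).
Proof.
split; first by apply/cocycleP; rewrite raddf0.
move=> c d /cocycleP c0 /cocycleP d0; apply/cocycleP.
by rewrite raddfB /= c0 d0 subr0.
Qed.
HB.instance Definition _ k :=
  GRing.isZmodClosed.Build _ (@cocycle k) (@cocycle_closed k).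

Record cocycles k := Cocycle {
  cocycle_val :> cochain k; _ : cocycle_val \in @cocycle k }.
HB.instance Definition _ k := [isSub for @cocycle_val k].
HB.instance Definition _ k := [Choice of cocycles k by <:].
HB.instance Definition _ k := [SubChoice_isSubZmodule of cocycles k by <:].

Definition is_coboundary k : cochain k -> Prop :=
  if k is k'.+1 then fun c => exists b : cochain k', c = coboundary b
  else fun c => c = 0.

Definition exact_cocycle k : {pred cocycles k} :=
  [pred c | `[< is_coboundary (val c) >]].
Lemma exact_cocycle_closed k : zmod_closed (@exact_cocycle k).
Proof.
split.
  by apply/asboolP; case: k => [|k] //=; exists 0; rewrite raddf0.
move=> c d /asboolP hc /asboolP hd; apply/asboolP; rewrite raddfB /=.
case: k c d hc hd => [|k] c d /=; first by move=> -> ->; rewrite subr0.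
by move=> [b ->] [b' ->]; exists (b - b'); rewrite raddfB.
Qed.
HB.instance Definition _ k :=
  GRing.isZmodClosed.Build _ (@exact_cocycle k) (@exact_cocycle_closed k).

Definition cohomology k : zmodType := Quotient.quot (@exact_cocycle k).

End Cochains.

Section Pullback.
Variables (R : realType) (A : zmodType).

Section Map.
Variables (X Y : topologicalType) (f : continuousType X Y) (k : nat).

Definition pull_cochain (c : cochain R Y A k) : cochain R X A k :=
  fun s => c (f \o s).

Lemma pull_cochain_is_zmod_morphism : zmod_morphism pull_cochain.
Proof. by []. Qed.
HB.instance Definition _ := GRing.isZmodMorphism.Build _ _ pull_cochain
  pull_cochain_is_zmod_morphism.

End Map.

Lemma coboundary_pull (X Y : topologicalType) (f : continuousType X Y) k
    (c : cochain R Y A k) :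
  coboundary (pull_cochain f c) = pull_cochain f (coboundary c).
Proof.
apply/funext => s; apply: eq_bigr => i _; congr (c _ *~ _).
exact/continuousEP.
Qed.

Section CohomologyMap.
Variables (X Y : topologicalType) (f : continuousType X Y) (k : nat).

Lemma pull_cocycle_subproof (c : cocycles R Y A k) :
  pull_cochain f c \in @cocycle R X A k.
Proof.
apply/cocycleP; have /cocycleP c0 : cocycle_val c \in @cocycle R Y A k := valP c.
by rewrite coboundary_pull c0 raddf0.
Qed.

Definition pull_cocycle (c : cocycles R Y A k) : cocycles R X A k :=
  Cocycle (pull_cocycle_subproof c).

Lemma pull_cocycle_is_zmod_morphism : zmod_morphism pull_cocycle.
Proof. by move=> c d; apply: val_inj. Qed.
HB.instance Definition _ := GRing.isZmodMorphism.Build _ _ pull_cocycle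
  pull_cocycle_is_zmod_morphism.

Lemma pull_exact c :
  c \in @exact_cocycle R Y A k -> pull_cocycle c \in @exact_cocycle R X A k.
Proof.
move=> /asboolP hc; apply/asboolP; rewrite /=.
case: k c hc => [|k'] c /=; first by move=> ->; rewrite raddf0.
by move=> [b ->]; exists (pull_cochain f b); rewrite coboundary_pull.
Qed.

Definition cohomology_map (a : cohomology R Y A k) : cohomology R X A k :=
  \pi_(cohomology R X A k) (pull_cocycle (repr a)).

End CohomologyMap.

Definition cohomology_class (X : topologicalType) k (c : cocycles R X A k) :
  cohomology R X A k := \pi_(cohomology R X A k) c.

Lemma cohomology_class_eq (X : topologicalType) k (c d : cocycles R X A k) :
  cohomology_class c = cohomology_class d <-> c - d \in @exact_cocycle R X A k.
Proof.
rewrite Quotient.idealrBE; split=> [/eqP //|/eqP]; exact.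
Qed.

Lemma cohomology_mapE (X Y : topologicalType) (f : continuousType X Y) k
    (c : cocycles R Y A k) :
  cohomology_map f (cohomology_class c) = cohomology_class (pull_cocycle f c).
Proof.
apply/cohomology_class_eq; rewrite -raddfB; apply: pull_exact.
by apply/cohomology_class_eq; rewrite /cohomology_class reprK.
Qed.

Lemma cohomology_class_surj (X : topologicalType) k (a : cohomology R X A k) :
  exists c, a = cohomology_class c.
Proof. by exists (repr a); rewrite /cohomology_class reprK. Qed.

Lemma cohomology_map_is_zmod_morphism (X Y : topologicalType)
  (f : continuousType X Y) k : zmod_morphism (@cohomology_map X Y f k).
Proof.
move=> a b; have [c ->] := cohomology_class_surj a.
have [d ->] := cohomology_class_surj b.
rewrite -[cohomology_class c - _](raddfB (\pi_(cohomology R Y A k))).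
rewrite !cohomology_mapE raddfB.
exact: (raddfB (\pi_(cohomology R X A k))).
Qed.
HB.instance Definition _ (X Y : topologicalType) (f : continuousType X Y) k :=
  GRing.isZmodMorphism.Build _ _ (@cohomology_map X Y f k)
    (@cohomology_map_is_zmod_morphism X Y f k).

Lemma cohomology_map_id (X : topologicalType) (f : continuousType X X) k
    (a : cohomology R X A k) :
  (forall x, f x = x) -> cohomology_map f a = a.
Proof.
move=> fid; have [c ->] := cohomology_class_surj a; rewrite cohomology_mapE.
congr cohomology_class; apply: val_inj; apply/funext => s /=.
by congr (cocycle_val c _); apply/continuousEP => x /=; rewrite fid.
Qed.

Lemma cohomology_map_comp (X Y Z : topologicalType) (f : continuousType X Y)
    (g : continuousType Y Z) (h : continuousType X Z) k
    (a : cohomology R Z A k) :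
  (forall x, h x = g (f x)) ->
  cohomology_map h a = cohomology_map f (cohomology_map g a).
Proof.
move=> hgf; have [c ->] := cohomology_class_surj a; rewrite !cohomology_mapE.
congr cohomology_class; apply: val_inj; apply/funext => s /=.
by congr (cocycle_val c _); apply/continuousEP => x /=; rewrite hgf.
Qed.

End Pullback.

Record pro_space (I : filtering_category) := ProSpace {
  pro_obj :> I -> topologicalType;
  pro_hausdorff : forall i, hausdorff_space (pro_obj i);
  pro_map : forall i j : I, hom i j -> continuousType (pro_obj j) (pro_obj i);
  pro_map_id : forall i x, pro_map (idm i) x = x;
  pro_map_comp : forall i j k (v : hom j k) (u : hom i j) x,
    pro_map (comp v u) x = pro_map u (pro_map v x) }.
Arguments pro_map {I} p {i j}.

Section ProCohomology.
Variables (R : realType) (I : filtering_category) (X : pro_space I).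

Definition cohomology_system (A : zmodType) (k : nat) : direct_system I :=
  @DirectSystem I (fun i => cohomology R (X i) A k)
    (fun i j u => @cohomology_map R A _ _ (pro_map X u) k)
    (fun i a => cohomology_map_id a (@pro_map_id I X i))
    (fun i j l v u a =>
       cohomology_map_comp a (@pro_map_comp I X i j l v u)).

Definition pro_cohomology (A : zmodType) (k : nat) : zmodType :=
  dirlim (cohomology_system A k).

Definition acyclic_mod (p : nat) : Prop :=
  (exists f : {additive pro_cohomology 'F_p 0 -> 'F_p}, bijective f) /\
  (forall k, (0 < k)%N -> forall a : pro_cohomology 'F_p k, a = 0).

End ProCohomology.

Section Actions.
Variable G : finGroupType.

(* [G] is discrete, so joint continuity of the action amounts to the
   continuity of each translation. *)
Record left_action (X : topologicalType) := LeftAction {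
  act :> G -> X -> X;
  act_continuous : forall g, continuous (act g);
  act_one : forall x, act 1%g x = x;
  act_mul : forall g h x, act (g * h)%g x = act g (act h x) }.

Definition fixed_points (X : topologicalType) (h : left_action X) : set X :=
  [set x | forall g, h g x = x].

Record pro_action (I : filtering_category) (X : pro_space I) := ProAction {
  pro_act :> forall i, left_action (X i);
  pro_act_equivariant : forall (i j : I) (u : hom i j) g x,
    pro_map X u (pro_act j g x) = pro_act i g (pro_map X u x) }.

Lemma set_type_hausdorff (X : topologicalType) (A : set X) :
  hausdorff_space X -> hausdorff_space A.
Proof.
rewrite !open_hausdorff => sepX x y xy.
have /sepX[[U V] /= [xU yV] [oU oV UV0]] : val x != val y.
  by apply: contra xy => /eqP /val_inj ->.
exists (val @^-1` U, val @^-1` V); first by split; apply/mem_set;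
  [move/set_mem: xU | move/set_mem: yV].
split=> /=; [by exists U| by exists V|].
by rewrite -preimage_setI (eqP UV0) preimage_set0.
Qed.

Section FixedPro.
Variables (I : filtering_category) (X : pro_space I) (h : pro_action X).

Section Restriction.
Variables (i j : I) (u : hom i j).

Lemma pro_map_fixed (x : fixed_points (h j)) :
  pro_map X u (val x) \in fixed_points (h i).
Proof.
apply/mem_set => g; rewrite -pro_act_equivariant.
by rewrite (set_mem (valP x) g).
Qed.

Definition fixed_map_fun (x : fixed_points (h j)) : fixed_points (h i) :=
  exist _ (pro_map X u (val x)) (pro_map_fixed x).

Lemma fixed_map_continuous : continuous fixed_map_fun.
Proof.
apply: continuous_comp_initial => x.
have -> : set_val \o fixed_map_fun = pro_map X u \o set_val by [].
apply: continuous_comp.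
  exact: initial_continuous.
exact: cts_fun.
Qed.

Definition fixed_map :
    continuousType (fixed_points (h j)) (fixed_points (h i)) :=
  mkcts fixed_map_continuous.

End Restriction.

Lemma fixed_map_id i x : fixed_map (idm i) x = x.
Proof. by apply: val_inj; rewrite /= pro_map_id. Qed.

Lemma fixed_map_comp i j k (v : hom j k) (u : hom i j) x :
  fixed_map (comp v u) x = fixed_map u (fixed_map v x).
Proof. by apply: val_inj; rewrite /= pro_map_comp. Qed.

Definition fixed_pro : pro_space I :=
  @ProSpace I (fun i => fixed_points (h i))
    (fun i => set_type_hausdorff (@pro_hausdorff I X i))
    fixed_map fixed_map_id fixed_map_comp.

End FixedPro.

End Actions.

Section Discs.
Variable R : realType.

(* Euclidean discs: the library's norm on matrices is the sup norm. *)
Definition disc n : set 'rV[R]_n := [set x | \sum_j x ord0 j ^+ 2 <= 1].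
Definition open_disc n : set 'rV[R]_n := [set x | \sum_j x ord0 j ^+ 2 < 1].
Definition sphere n : set 'rV[R]_n := [set x | \sum_j x ord0 j ^+ 2 = 1].

End Discs.
Arguments disc : clear implicits.
Arguments open_disc : clear implicits.
Arguments sphere : clear implicits.

(* The equivariant cell [e] is a copy of [G/H x D^n] with [H = gcw_stab e] and
   [n = gcw_dim e].  A G-map [G/H x D^n -> X], which sends [(gH, x)] to
   [g . phi x], is the same as a continuous [phi : D^n -> X^H]; this [phi] is
   [gcw_char e], whose values outside of the disc are irrelevant.  The union of
   the open cells of dimension less than [n] is the [(n-1)]-skeleton, and the
   topology of [X] is the quotient topology from the disjoint union of the
   closed cells. *)
Definition open_cell (R : realType) (G : finGroupType) (X : topologicalType)
    (h : left_action G X) n (phi : 'rV[R]_n -> X) : set X :=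
  [set h g (phi x) | g in [set: G] & x in open_disc R n].

Unset Implicit Arguments.
Record finite_GCW (R : realType) (G : finGroupType) (X : topologicalType)
    (h : left_action G X) := FiniteGCW {
  gcw_cell : finType;
  gcw_dim : gcw_cell -> nat;
  gcw_stab : gcw_cell -> {group G};
  gcw_char : forall e, 'rV[R]_(gcw_dim e) -> X;
  gcw_char_continuous : forall e,
    {within disc R (gcw_dim e), continuous (gcw_char e)};
  gcw_char_stab : forall e g x,
    g \in gcw_stab e -> disc R (gcw_dim e) x ->
    h g (gcw_char e x) = gcw_char e x;
  gcw_char_inj : forall e g g' x x',
    open_disc R (gcw_dim e) x -> open_disc R (gcw_dim e) x' ->
    h g (gcw_char e x) = h g' (gcw_char e x') ->
    (g *: gcw_stab e = g' *: gcw_stab e)%g /\ x = x';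
  gcw_disjoint : forall e e' y,
    open_cell h (gcw_char e) y -> open_cell h (gcw_char e') y -> e = e';
  gcw_cover : forall y, exists e, open_cell h (gcw_char e) y;
  gcw_attach : forall e x, sphere R (gcw_dim e) x ->
    exists2 e', (gcw_dim e' < gcw_dim e)%N
              & open_cell h (gcw_char e') (gcw_char e x);
  gcw_weak_topology : forall B : set X,
    (forall e g,
       closed (disc R (gcw_dim e) `&` [set x | B (h g (gcw_char e x))])) ->
    closed B }.
Arguments finite_GCW R {G X} h.
Arguments gcw_cell {R G X h} _.
Arguments gcw_dim {R G X h _} _.
Arguments gcw_stab {R G X h _} _.
Arguments gcw_char {R G X h _} _ _.
Set Implicit Arguments.

(* Main.v *)
Require Import Defs.
From HB Require Import structures.
From mathcomp Require Import all_boot all_order all_algebra all_fingroup.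
From mathcomp Require Import generic_quotient cyclic.
From mathcomp Require Import all_classical all_reals all_analysis.
From mathcomp Require Import ring lra zify.

(** Smith theory.  For a generator t of G and tau = 1 - t, sigma = 1 + t + ... +
    t^(p-1), the singular simplices which are not fixed by t form a free G-set, so
    that there are short exact sequences of cochain complexes
    0 -> rho M -> C(X_i) -> rho' M + C(X_i^G) -> 0 with {rho, rho'} = {tau, sigma},
    where M consists of the cochains vanishing on the fixed simplices.  In the
    direct limit C(X) is acyclic, hence the connecting maps
    H^n(rho' M) + H^n(X^G) -> H^(n+1)(rho M) are injective for n > 0, and in degree
    0 their kernel is spanned by the constants.  It is therefore enough that some
    iterate of the connecting maps vanishes on H(rho M) for each finite G-CW complex
    X_i.  This is shown cell by cell: attaching a free cell costs one connecting map,
    because the new part is covered by a neighborhood which is pushed into the old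
    part by an equivariant homotopy and by the open cell, whose translates are
    disjoint.  The two pieces are put together by barycentric subdivision. *)

Set Implicit Arguments.
Unset Strict Implicit.
Unset Printing Implicit Defensive.

Import Order.TTheory GRing.Theory Num.Theory.
Import numFieldNormedType.Exports.

Local Open Scope classical_set_scope.
Local Open Scope ring_scope.
Local Open Scope quotient_scope.

(** * Cochains on lists of vertices *)

(** Subdivision and homotopies are natural, so they are built once as formulas on lists of vertices
    in a real vector space, where the coboundary is a recursion over cones; [ev] carries them over
    to singular cochains. Naturality makes them commute with t, hence preserve the kernels of tau
    and sigma. The obstacle is that a cover controls a cochain on small simplices only, and no
    number of subdivisions serves all simplices of a space. A number common to the finite orbit of a
    simplex is enough to keep the correction inside the kernel. Everything is done with cochains
    instead of cohomology classes: a connecting map is the choice of a preimage under rho followed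
    by the coboundary, and the freedom in that choice is what the free cells require. Injectivity of
    the connecting maps holds in the limit only and nilpotency for each space separately; together
    they annihilate the special cohomology of the limit, into which the positive cohomology of the
    fixed points embeds. *)

Fixpoint all_in (V : Type) (K : set V) (l : seq V) : Prop :=
  if l is v :: l' then K v /\ all_in K l' else True.

Lemma all_in_map (V V' : Type) (K : set V) (K' : set V') (f : V -> V') l :
  (forall v, K v -> K' (f v)) -> all_in K l -> all_in K' (map f l).
Proof. by move=> KK'; elim: l => [|v l IH] //= [/KK' ? /IH]. Qed.

Section ListCochains.
Variables (V : Type) (A : comNzRingType).
Implicit Types (F : seq V -> A) (l : seq V) (K : set V).

(* The alternating sum of [F] over the lists obtained from [l] by deleting one
   entry, written recursively as the boundary of the cone over the tail. *)
Fixpoint lbd F l : A :=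
  if l is v :: l' then F l' - lbd (fun w => F (v :: w)) l' else 0.

Lemma lbdB F F' l : lbd (fun w => F w - F' w) l = lbd F l - lbd F' l.
Proof.
by elim: l F F' => [|v l IH] F F' /=; [rewrite subr0 | rewrite IH; ring].
Qed.

Lemma lbd0 l : lbd (fun=> 0) l = 0.
Proof. by elim: l => //= _ l ->; rewrite subr0. Qed.

Lemma lbd_lbd F l : lbd (lbd F) l = 0.
Proof.
elim: l F => [|v l IH] F //=.
by rewrite lbdB IH subr0 subrr.
Qed.

Lemma lbd_ext K F F' l : all_in K l ->
  (forall w, size w = (size l).-1 -> all_in K w -> F w = F' w) ->
  lbd F l = lbd F' l.
Proof.
elim: l F F' => [|v l IH] F F' //= [Kv Kl] FF'.
rewrite FF' //; congr (_ - _); case: l IH Kl FF' => [|v' l] // IH Kl FF'.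
by apply: IH => // w sw Kw; apply: FF' => //=; rewrite sw.
Qed.

Lemma lbd_sum F l : lbd F l =
  \sum_(i < size l) F (take i l ++ drop i.+1 l) *~ (-1) ^+ i.
Proof.
elim: l F => [|v l IH] F /=; first by rewrite big_ord0.
rewrite big_ord_recl /= drop0 mulr1z IH -sumrN; congr (_ + _).
by apply: eq_bigr => i _; rewrite exprS mulN1r mulrNz.
Qed.

End ListCochains.

Lemma lbd_map (V V' : Type) (A : comNzRingType) (f : V -> V')
    (F : seq V' -> A) l :
  lbd F (map f l) = lbd (fun w => F (map f w)) l.
Proof. by elim: l F => [|v l IH] F //=; rewrite IH. Qed.

Lemma all_inT (V : Type) (l : seq V) : all_in setT l.
Proof. by elim: l. Qed.

Lemma eq_lbd (V : Type) (A : comNzRingType) (F F' : seq V -> A) l :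
  (forall w, size w = (size l).-1 -> F w = F' w) -> lbd F l = lbd F' l.
Proof. by move=> e; apply: (lbd_ext (all_inT l)) => w sw _; apply: e. Qed.

Section Homotopy.
Variables (V W : Type) (A : comNzRingType) (b : seq V -> W).
Variable Phi : (seq W -> A) -> seq V -> A.
Hypothesis PhiB : forall F F' l,
  Phi (fun w => F w - F' w) l = Phi F l - Phi F' l.
Hypothesis Phi_nil : forall F, Phi F [::] = 0.
Hypothesis Phi_lbd : forall F l, Phi (lbd F) l = lbd (Phi F) l.

(* The method of acyclic models with cones of apex [b l]: the recursion solves
   [hpt (lbd F) + lbd (hpt F) = Phi F] for every chain map [Phi]. *)
Fixpoint hpt_rec n (F : seq W -> A) (l : seq V) : A :=
  if n is n'.+1 then
    Phi (fun w => F (b l :: w)) l - lbd (hpt_rec n' (fun w => F (b l :: w))) l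
  else 0.

Definition hpt F l := hpt_rec (size l) F l.

Lemma hptE F l : hpt F l =
  Phi (fun w => F (b l :: w)) l - lbd (hpt (fun w => F (b l :: w))) l.
Proof.
case: l => [|v l]; first by rewrite /hpt /= Phi_nil subr0.
have -> : hpt F (v :: l) = Phi (fun w => F (b (v :: l) :: w)) (v :: l) -
  lbd (hpt_rec (size l) (fun w => F (b (v :: l) :: w))) (v :: l) by [].
by congr (_ - _); apply: eq_lbd => w sw; rewrite /hpt sw.
Qed.

Lemma hptB F F' l : hpt (fun w => F w - F' w) l = hpt F l - hpt F' l.
Proof.
rewrite /hpt; move: (size l) => n; elim: n F F' l => [|n IH] F F' l /=.
  by rewrite subr0.
rewrite PhiB -[lbd (hpt_rec n _) l]/(lbd (hpt_rec n (fun w =>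
  F (b l :: w) - F' (b l :: w))) l).
rewrite (eq_lbd (F' := fun w => hpt_rec n (fun w => F (b l :: w)) w -
  hpt_rec n (fun w => F' (b l :: w)) w)) ?lbdB; last by move=> w _; rewrite IH.
by ring.
Qed.

(** The cone identity turns [hpt (lbd F) l] into terms in [F - lbd Fb] on [l] and on its faces. By
    induction the faces contribute [hpt F - (Phi Fb - lbd (hpt Fb))], and what is left cancels by
    [lbd_lbd] and because [Phi] is a cochain map. *)
Lemma hpt_lbd F l : hpt (lbd F) l + lbd (hpt F) l = Phi F l.
Proof.
have [n] := ubnP (size l); elim: n F l => // n IH F l sl.
case: l sl => [|v l] sl; first by rewrite /hpt /= Phi_nil addr0.
set l' := v :: l; rewrite hptE; set Fb := fun w => F (b l' :: w).
have -> : (fun w => lbd F (b l' :: w)) = (fun w => F w - lbd Fb w) by [].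
rewrite PhiB Phi_lbd.
rewrite (@eq_lbd _ _ (hpt _) (fun w => hpt F w - (Phi Fb w - lbd (hpt Fb) w))).
  by rewrite !lbdB lbd_lbd; ring.
by move=> w sw; rewrite hptB -IH ?addrK // sw.
Qed.

(** The carrier of the homotopy: on a list in [K], only values of [F] on lists in [K'] with one more
    vertex enter. Applied to differences, this also compares cochains that agree on the carrier
    only. *)
Lemma hpt_eq0 (K : set V) (K' : set W) F l :
    (forall w, (0 < size w)%N -> all_in K w -> K' (b w)) ->
    (forall F l, all_in K l ->
      (forall w, size w = size l -> all_in K' w -> F w = 0) -> Phi F l = 0) ->
  all_in K l ->
  (forall w, size w = (size l).+1 -> all_in K' w -> F w = 0) -> hpt F l = 0.
Proof.
move=> Kb Phi0; have [n] := ubnP (size l); elim: n F l => // n IH F l.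
case: l => [|v l] sl Kl F0; first by rewrite /hpt.
have Kbl := Kb (v :: l) isT Kl; rewrite hptE Phi0 //; last first.
  by move=> w sw Kw; apply: F0; rewrite /= ?sw.
rewrite sub0r (lbd_ext (F' := fun=> 0) Kl); last first.
  move=> w sw Kw; apply: IH => //; first by rewrite sw.
  by move=> w' sw' Kw'; apply: F0; rewrite /= ?sw' ?sw.
by rewrite lbd0 oppr0.
Qed.

End Homotopy.

Lemma hpt_map (V W V' W' : Type) (A : comNzRingType)
    (b : seq V -> W) (b' : seq V' -> W')
    (Phi : (seq W -> A) -> seq V -> A) (Phi' : (seq W' -> A) -> seq V' -> A)
    (f : V -> V') (g : W -> W') F l :
    (forall w, (0 < size w)%N -> b' (map f w) = g (b w)) ->
    (forall F w, Phi' F (map f w) = Phi (fun u => F (map g u)) w) ->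
  hpt b' Phi' F (map f l) = hpt b Phi (fun u => F (map g u)) l.
Proof.
move=> fb fPhi; rewrite /hpt size_map.
move: {-1}(size l) (erefl (size l)) => n; elim: n F l => // n IH F l sl.
have l0 : (0 < size l)%N by rewrite sl.
rewrite [LHS]/= [RHS]/= fPhi fb // lbd_map; congr (_ - _).
by apply: eq_lbd => w sw; rewrite IH // sw sl.
Qed.

Section Subdivision.
Variables (V : Type) (A : comNzRingType) (b : seq V -> V).
Implicit Types (F : seq V -> A) (l : seq V).

(* The dual of barycentric subdivision: the subdivision of a simplex is the cone
   with apex its barycenter [b l] over the subdivision of its boundary. *)
Fixpoint sd_rec n F l : A :=
  if n is n'.+1 then lbd (sd_rec n' (fun w => F (b l :: w))) l else F [::].

Definition sd F l := sd_rec (size l) F l.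

Lemma sdE F l : (0 < size l)%N -> sd F l = lbd (sd (fun w => F (b l :: w))) l.
Proof.
case: l => [|v l] // _.
have -> : sd F (v :: l) =
  lbd (sd_rec (size l) (fun w => F (b (v :: l) :: w))) (v :: l) by [].
by apply: eq_lbd => w sw; rewrite /sd sw.
Qed.

Lemma sdB F F' l : sd (fun w => F w - F' w) l = sd F l - sd F' l.
Proof.
rewrite /sd; move: (size l) => n; elim: n F F' l => [|n IH] F F' l //=.
by rewrite -lbdB; apply: eq_lbd => w _; rewrite IH.
Qed.

Lemma sd_lbd F l : sd (lbd F) l = lbd (sd F) l.
Proof.
have [n] := ubnP (size l); elim: n F l => // n IH F l sl.
case: l sl => [|v l] sl; first by [].
rewrite sdE //; set l' := v :: l; set Fb := fun w => F (b l' :: w).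
have -> : (fun w => lbd F (b l' :: w)) = (fun w => F w - lbd Fb w) by [].
rewrite (eq_lbd (F' := fun w => sd F w - lbd (sd Fb) w)).
  by rewrite lbdB lbd_lbd subr0.
by move=> w sw; rewrite sdB IH // sw.
Qed.

Lemma sd_eq0 (K : set V) F l :
    (forall w, (0 < size w)%N -> all_in K w -> K (b w)) -> all_in K l ->
    (forall w, size w = size l -> all_in K w -> F w = 0) ->
  sd F l = 0.
Proof.
move=> Kb; have [n] := ubnP (size l); elim: n F l => // n IH F l.
case: l => [|v l] sl Kl F0; first exact: F0.
rewrite sdE // (lbd_ext (F' := fun=> 0) Kl) ?lbd0 // => w sw Kw.
apply: IH => //; first by rewrite sw.
move=> w' sw' Kw'; apply: F0; first by rewrite /= sw' sw.
by split=> //; apply: Kb.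
Qed.

End Subdivision.

Lemma sd_map (V V' : Type) (A : comNzRingType)
    (b : seq V -> V) (b' : seq V' -> V') (f : V -> V') (F : seq V' -> A) l :
    (forall w, (0 < size w)%N -> b' (map f w) = f (b w)) ->
  sd b' F (map f l) = sd b (fun u => F (map f u)) l.
Proof.
move=> fb; have [n] := ubnP (size l); elim: n F l => // n IH F [|v l] // sl.
rewrite !sdE // fb // lbd_map; apply: eq_lbd => w sw.
by rewrite IH // sw.
Qed.

(** * Cyclic actions of prime order *)

Lemma sum_shift (A : zmodType) n (F : nat -> A) : F n = F 0%N ->
  \sum_(i < n) F i.+1 = \sum_(i < n) F i.
Proof.
case: n => [|n] Fn; first by rewrite !big_ord0.
by rewrite big_ord_recr [RHS]big_ord_recl /= Fn addrC.
Qed.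

Section CyclicAction.
Variables (p : nat) (T : Type) (t : T -> T).
Hypotheses (p_pr : prime p) (tp : forall s, iter p t s = s).

Let p_gt0 : (0 < p)%N. Proof. exact: prime_gt0. Qed.
Let p_gt1 : (1 < p)%N. Proof. exact: prime_gt1. Qed.

Lemma iter_mod s n : iter (n %% p) t s = iter n t s.
Proof.
rewrite [in RHS](divn_eq n p) addnC iterD; congr iter.
by elim: (n %/ p)%N => // k IH; rewrite mulSn iterD -IH tp.
Qed.

(** By Bezout, [i] is invertible modulo [p], so [t] is itself a power of [iter i t]. Orbits of
    points that are not fixed are therefore free. *)
Lemma iter_eq_fix s i : (0 < i < p)%N -> iter i t s = s -> t s = s.
Proof.
move=> /andP[i0 ip] si.
have mulE k n : iter n t s = s -> iter (k * n) t s = s.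
  by move=> sn; elim: k => // k IH; rewrite mulSn iterD IH sn.
have co : gcdn i p = 1%N.
  by apply/eqP; rewrite -/(coprime i p) coprime_sym prime_coprime // gtnNdvd.
case: (egcdnP p i0) => u v; rewrite co addn1 => uv _.
by rewrite -{2}(mulE u i si) uv iterS mulE.
Qed.

(* [idx] is the position in an orbit, counted from a representative which lies in
   [Q] whenever the orbit meets [Q]. *)
Lemma orbit_index (Q : set T) :
    (forall s i, Q s -> Q (iter i t s) -> (i < p)%N -> i = 0%N) ->
  exists idx : T -> nat,
    [/\ forall s, (idx s < p)%N,
        forall s, t s <> s -> idx (t s) = ((idx s).+1 %% p)%N
      & forall s i, Q s -> (i < p)%N -> idx (iter i t s) = i].
Proof.
move=> Q1.
have iter_inj s i j : t s <> s -> (i < p)%N -> (j < p)%N ->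
    iter i t s = iter j t s -> i = j.
  move=> ns; wlog ij : i j / (i <= j)%N.
    by case/orP: (leq_total i j) => ij w ip jp e; [apply: w|symmetry; apply: w].
  move=> ip jp e; apply/eqP; rewrite eqn_leq ij leqNgt; apply/negP => lij.
  apply: ns; apply: (@iter_eq_fix s (j - i)); first lia.
  have back : iter (p - i) t (iter i t s) = s by rewrite -iterD subnK ?tp // ltnW.
  rewrite -[in LHS]back -iterD -iterD.
  have -> : (j - i + (p - i) + i = (p - i) + j)%N by lia.
  by rewrite iterD -e.
pose orb s := [set s' | exists2 i, (i < p)%N & s' = iter i t s].
have orbS s : orb (t s) = orb s.
  apply/seteqP; split => s' [i ip ->].
    exists (i.+1 %% p)%N; first by rewrite ltn_mod.
    by rewrite iter_mod iterSr.
  exists ((i + p.-1) %% p)%N; first by rewrite ltn_mod.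
  by rewrite iter_mod -iterSr -addnS prednK // iterD tp.
(* [P s] depends on [s] through its orbit only, so the representative chosen from it is constant
   along orbits. *)
pose P s := [set s' | orb s s' /\ ((exists2 q, orb s q & Q q) -> Q s')].
have orb_id s : orb s s by exists 0%N.
have Pex s : exists s', P s s'.
  have [[q oq Qq]|nq] := pselect (exists2 q, orb s q & Q q); first by exists q.
  by exists s.
pose rep s := projT1 (cid (Pex s)).
have repP s : P s (rep s) by rewrite /rep; case: cid.
have repS s : rep (t s) = rep s.
  have PS : P (t s) = P s by rewrite /P orbS.
  rewrite /rep; move: (Pex (t s)) (Pex s); rewrite PS => e e'.
  by rewrite (Prop_irrelevance e e').
have idxE s : exists i, (i < p)%N /\ iter i t (rep s) = s.
  have [[i ip si] _] := repP s; exists ((p - i) %% p)%N.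
  by rewrite ltn_mod iter_mod si -iterD subnK ?tp // ltnW.
pose idx s := projT1 (cid (idxE s)).
have idxP s : (idx s < p)%N /\ iter (idx s) t (rep s) = s.
  by rewrite /idx; case: cid.
exists idx; split; first by move=> s; have [] := idxP s.
- move=> s ns.
  have nr : t (rep s) <> rep s.
    move=> r; apply: ns; have [_ <-] := idxP s.
    by elim: (idx s) => [|k IH] /=; rewrite ?r ?IH.
  have [_ e] := idxP s; have [lt' e'] := idxP (t s); rewrite repS in e'.
  apply: (iter_inj (rep s)) => //; first by rewrite ltn_mod.
  by rewrite e' iter_mod iterS e.
- move=> s j Qs jp; have [[i ip si] Qr] := repP s.
  have i0 : i = 0%N.
    by apply: (Q1 s i Qs) => //; rewrite -si; apply: Qr; exists s.
  have ns : t s <> s by move=> fs; have := Q1 s 1%N Qs; rewrite /= fs => /(_ Qs p_gt1).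
  have repj : rep (iter j t s) = s.
    by rewrite -[RHS]/(iter 0 t s) -i0 -si; elim: {jp}j => //= j; rewrite repS.
  have [lt e] := idxP (iter j t s); rewrite repj in e.
  exact: (iter_inj s).
Qed.

(* [rho false] is the multiplication by 1 - t and [rho true] the one by the
   norm 1 + t + ... + t^(p-1). *)
Definition rho (b : bool) (c : T -> 'F_p) (s : T) : 'F_p :=
  if b then \sum_(i < p) c (iter i t s) else c s - c (t s).

(** A preimage of [c] under [rho b]. For the norm it is [c] cut down to the representatives. For 1 -
    t it is a discrete primitive: if s = t^k r with representative r and k = [idx s], the value is
    minus the sum of c(t^j r) over j < k, written with iterates of [s] by means of t^p = 1. *)
Definition rho_lift (idx : T -> nat) (b : bool) (c : T -> 'F_p) (s : T) : 'F_p :=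
  if b then if idx s == 0%N then c s else 0
  else - \sum_(p - idx s <= l < p) c (iter l t s).

Lemma rho_fixed b c s : t s = s -> rho b c s = 0.
Proof.
move=> fs; rewrite /rho; case: b; last by rewrite fs subrr.
rewrite (eq_bigr (fun=> c s)); last by move=> i _; congr c; elim: (val i) => //= k ->.
by rewrite sumr_const card_ord -mulr_natl pchar_Fp_0 ?mul0r.
Qed.

Lemma rho_rho b c s : rho b (rho (~~ b) c) s = 0.
Proof.
have st : \sum_(i < p) c (iter i.+1 t s) = \sum_(i < p) c (iter i t s).
  by apply: (sum_shift (F := fun i => c (iter i t s))); rewrite tp.
rewrite /rho; case: b => /=; first by rewrite sumrB st subrr.
by under [X in _ - X]eq_bigr => i _ do rewrite -iterSr; rewrite st subrr.
Qed.

Lemma rho_liftK idx b c :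
    (forall s, (idx s < p)%N) ->
    (forall s, t s <> s -> idx (t s) = ((idx s).+1 %% p)%N) ->
    (forall s, t s = s -> c s = 0) -> (forall s, rho (~~ b) c s = 0) ->
  forall s, rho b (rho_lift idx b c) s = c s.
Proof.
move=> idx_lt idxS c_fix c0 s.
have [fs|ns] := pselect (t s = s); first by rewrite rho_fixed // c_fix.
case: b c0 => /= c0.
- have ct s' : c (t s') = c s' by have /eqP := c0 s'; rewrite subr_eq0 => /eqP.
  have ci i s' : c (iter i t s') = c s' by elim: i => //= i <-.
  have idxi i : idx (iter i t s) = ((idx s + i) %% p)%N.
    elim: i => [|i IH]; first by rewrite addn0 modn_small.
    rewrite iterS idxS; first by rewrite IH -[X in (X %% p)%N]addn1 modnDml addn1 addnS.
    move=> fi; apply: ns.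
    have back : iter (p - i %% p) t (iter i t s) = s.
      by rewrite -(iter_mod s) -iterD subnK ?tp // ltnW // ltn_mod.
    by rewrite -[in LHS]back -[RHS]back -iterS iterSr fi.
  (* Exactly one point of the orbit has index 0, namely the translate of [s] by p - [idx s] modulo
     [p]. *)
  rewrite /rho /rho_lift (bigD1 (Ordinal (ltn_pmod (p - idx s) p_gt0))) //=.
  rewrite idxi modnDmr subnKC ?(ltnW (idx_lt s)) // modnn eqxx ci big1 ?addr0 //.
  move=> i ne; rewrite idxi; case: ifP => // /eqP e; case/eqP: ne.
  apply: val_inj => /=; have ip := ltn_ord i; have ids := idx_lt s.
  have [i0|i0] := posnP (idx s).
    by rewrite i0 subn0 modnn; rewrite i0 add0n modn_small in e.
  rewrite modn_small; last by lia.
  have [lt|ge] := ltnP (idx s + i) p; first by rewrite modn_small in e; lia.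
  have e2 : (idx s + i = (idx s + i - p) + p)%N by lia.
  by move: e; rewrite e2 modnDr modn_small; lia.
- rewrite /rho /rho_lift /= idxS //; have ids := idx_lt s.
  (* The primitive telescopes unless [idx s] is p - 1. There the index wraps around to 0, and the
     vanishing of the norm of [c] closes the sum. *)
  have [lt|ge] := ltnP (idx s).+1 p.
    rewrite modn_small // opprK.
    have -> : \sum_(p - (idx s).+1 <= l < p) c (iter l t (t s)) =
        \sum_(p - idx s <= l < p.+1) c (iter l t s).
      have -> : (p - idx s = (p - (idx s).+1).+1)%N by lia.
      by rewrite big_add1; apply: eq_bigr => l _; rewrite -iterSr.
    by rewrite big_nat_recr ?leq_subr //= tp addKr.
  have -> : ((idx s).+1 = p)%N by lia.
  rewrite modnn subn0 (big_geq (leqnn p)) oppr0 subr0.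
  have -> : (p - idx s = 1)%N by lia.
  have := c0 s; rewrite /rho -(big_mkord xpredT (fun l => c (iter l t s))).
  by rewrite (big_ltn p_gt0) /= => /eqP; rewrite addrC addr_eq0 => /eqP ->; rewrite opprK.
Qed.

End CyclicAction.

(** * Barycenters and subdivision *)

Lemma all_inI (V : Type) (K L : set V) l :
  all_in K l -> all_in L l -> all_in (K `&` L) l.
Proof. by elim: l => //= v l IH [? ?] [? ?]; split; [split | apply: IH]. Qed.

Lemma sub_all_in (V : Type) (K L : set V) l :
  K `<=` L -> all_in K l -> all_in L l.
Proof. by move=> KL; elim: l => //= v l IH [? ?]; split; [apply: KL | apply: IH]. Qed.

Lemma all_in_nth (V : Type) (K : set V) x0 l :
  all_in K l <-> forall i, (i < size l)%N -> K (nth x0 l i).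
Proof.
split=> [|H]; first by elim: l => //= v l IH [Kv Kl] [|i] //=; apply: IH.
elim: l H => //= v l IH H; split; first exact: (H 0%N).
by apply: IH => i; apply: (H i.+1).
Qed.

Section Barycenter.
Variable R : realType.

Definition bar (V : lmodType R) (l : seq V) : V :=
  (size l)%:R^-1 *: \sum_(v <- l) v.

Lemma linear_morph (V V' : lmodType R) (f : V -> V') : linear f ->
  [/\ f 0 = 0, {morph f : u v / u + v} & forall a, {morph f : u / a *: u}].
Proof.
move=> lf; have fD u v : f (u + v) = f u + f v.
  by rewrite -[u]scale1r lf !scale1r.
have f0 : f 0 = 0 by have /eqP := fD 0 0; rewrite addr0 -subr_eq subrr => /eqP.
by split=> // a u; rewrite -[a *: u]addr0 lf f0 addr0.
Qed.

Lemma bar_map (V V' : lmodType R) (f : V -> V') l : linear f ->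
  bar (map f l) = f (bar l).
Proof.
move=> /linear_morph[f0 fD fZ].
rewrite /bar size_map big_map fZ; congr (_ *: _).
by elim: l => [|v l IH]; rewrite ?big_nil ?f0 // !big_cons fD IH.
Qed.

Definition affine_comb (V : lmodType R) (l : seq V) m (x : 'rV[R]_m.+1) : V :=
  \sum_(j < m.+1) x ord0 j *: nth 0 l j.

(** Convexity, stated for combinations of any number of points because it is applied to whole affine
    simplices. *)
Definition aff_closed (V : lmodType R) (K : set V) : Prop :=
  forall (l : seq V) m (x : 'rV[R]_m.+1), size l = m.+1 -> all_in K l ->
    std_simplex R m x -> K (affine_comb l x).

Lemma bar_affine (V : lmodType R) (l : seq V) m : size l = m.+1 ->
  exists2 x : 'rV[R]_m.+1, std_simplex R m x & bar l = affine_comb l x.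
Proof.
move=> sl; exists (\row_j m.+1%:R^-1); last first.
  rewrite /bar /affine_comb sl (big_nth 0) big_mkord sl scaler_sumr.
  by apply: eq_bigr => j _; rewrite mxE.
split=> [j|]; first by rewrite mxE invr_ge0.
under eq_bigr do rewrite mxE.
by rewrite sumr_const card_ord -[LHS]mulr_natr mulVf ?pnatr_eq0.
Qed.

Lemma bar_in (V : lmodType R) (K : set V) l : aff_closed K ->
  (0 < size l)%N -> all_in K l -> K (bar l).
Proof.
move=> cK; case: l => // v l _ Kl.
by have [x Sx ->] := bar_affine (erefl (size (v :: l))); apply: cK.
Qed.

Lemma aff_closedI (V : lmodType R) (K L : set V) :
  aff_closed K -> aff_closed L -> aff_closed (K `&` L).
Proof.
move=> cK cL l m x sl al Sx; split; [apply: cK|apply: cL] => //;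
  by apply: sub_all_in al => ? [].
Qed.

Lemma affine_combB (V : lmodType R) (l : seq V) m (x : 'rV[R]_m.+1) v :
  std_simplex R m x ->
  v - affine_comb l x = \sum_(j < m.+1) x ord0 j *: (v - nth 0 l j).
Proof.
move=> [_ x1]; rewrite -[v in LHS]scale1r -x1 scaler_suml -sumrB.
by apply: eq_bigr => j _; rewrite scalerBr.
Qed.

Lemma aff_closed_ball (V : normedModType R) (v : V) e :
  aff_closed [set w : V | `|v - w| <= e].
Proof.
move=> l m x sl /(all_in_nth _ 0) al Sx /=; rewrite affine_combB //.
have [x0 x1] := Sx.
apply: (le_trans (ler_norm_sum _ _ _)); rewrite -[e]mul1r -x1 mulr_suml.
apply: ler_sum => j _; rewrite normrZ ger0_norm //.
by apply: ler_wpM2l => //; apply: al; rewrite sl.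
Qed.

Definition diam_le (V : normedModType R) (D : set V) (e : R) :=
  forall x y, D x -> D y -> `|x - y| <= e.

(** In the average of the differences to one vertex, the term of that vertex is zero. This leaves
    the factor (k-1)/k for k vertices, which grows with k and is at most n/(n+1). *)
Lemma bar_dist (V : normedModType R) (D : set V) l e n : diam_le D e ->
  (size l <= n.+1)%N -> all_in D l ->
  all_in [set v : V | `|bar l - v| <= n%:R / n.+1%:R * e] l.
Proof.
move=> De sl /(all_in_nth _ 0) al; apply/(all_in_nth _ 0) => i il /=.
have l0 : (0 < size l)%N by case: l il {sl al}.
have e0 : 0 <= e by have := De _ _ (al _ il) (al _ il); rewrite subrr normr0.
have sl0 : (size l)%:R != 0 :> R by rewrite pnatr_eq0 -lt0n.
have -> : bar l - nth 0 l i =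
    (size l)%:R^-1 *: \sum_(j < size l | j != Ordinal il) (nth 0 l j - nth 0 l i).
  rewrite -[nth 0 l i in LHS](scalerK sl0) -scalerBr scaler_nat; congr (_ *: _).
  rewrite (big_nth 0) big_mkord -[X in _ *+ X]card_ord -sumr_const -sumrB.
  by rewrite (bigD1 (Ordinal il)) //= subrr add0r.
rewrite normrZ ger0_norm ?invr_ge0 //.
have le1 : `|\sum_(j < size l | j != Ordinal il) (nth 0 l j - nth 0 l i)| <=
    (size l).-1%:R * e.
  apply: (le_trans (ler_norm_sum _ _ _)).
  apply: (@le_trans _ _ (\sum_(j < size l | j != Ordinal il) e)).
    by apply: ler_sum => j _; apply: De; apply: al.
  by rewrite sumr_const -[leLHS]mulr_natl cardC1 card_ord.
apply: (le_trans (ler_wpM2l _ le1)); first by rewrite invr_ge0.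
rewrite mulrA; apply: ler_wpM2r => //.
rewrite mulrC ler_pdivrMr ?ltr0n // mulrAC ler_pdivlMr ?ltr0n //.
by rewrite -!natrM ler_nat; case: (size l) l0 sl => // k _ /=; lia.
Qed.

Definition small_eq0 (V : normedModType R) (A : comNzRingType) (K : set V) k e
    (F : seq V -> A) := forall (D : set V) l, size l = k -> all_in K l ->
  diam_le D e -> all_in D l -> F l = 0.

(* The ball of radius [n / n.+1 * e] around the barycenter is convex, so that the
   induction may go on inside it. *)
Lemma sd_small (V : normedModType R) (A : comNzRingType) (K : set V) k n e
    (F : seq V -> A) : (k <= n.+1)%N -> aff_closed K ->
  small_eq0 K k (n%:R / n.+1%:R * e) F -> small_eq0 K k e (sd (@bar V) F).
Proof.
elim: k K F => [|k IH] K F kn cK F0 D l sl Kl De Dl.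
  by case: l sl {Kl Dl} => // _; apply: (F0 set0).
have l0 : (0 < size l)%N by rewrite sl.
pose K' := K `&` [set v | `|bar l - v| <= n%:R / n.+1%:R * e].
have lK' : all_in K' l by apply: all_inI => //; apply: (bar_dist De); rewrite ?sl.
have cK' : aff_closed K' by apply: aff_closedI => //; exact: aff_closed_ball.
have F0' : small_eq0 K' k (n%:R / n.+1%:R * e) (fun w => F (bar l :: w)).
  move=> D' l' sl' Kl' De' Dl'.
  (* Adding the apex does not spoil the diameter, since [K'] lies in the ball of this radius around
     [bar l]. *)
  apply: (F0 ([set bar l] `|` (D' `&` K'))); rewrite /= ?sl' //.
  - by split; [apply: bar_in | apply: sub_all_in Kl' => ? []].
  - have e0 : 0 <= n%:R / n.+1%:R * e.
      by have /(all_in_nth _ 0)/(_ _ l0)[_] := lK'; apply: le_trans.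
    move=> x y [->|[D'x [_ Kx]]] [->|[D'y [_ Ky]]] //.
    + by rewrite subrr normr0.
    + by rewrite distrC.
    + exact: De'.
  - by split; [left | apply: sub_all_in (all_inI Dl' Kl') => ?; right].
rewrite sdE // (lbd_ext (F' := fun=> 0) (all_inI lK' Dl)) ?lbd0 // => w sw Kw.
apply: (IH K' _ (ltnW kn) cK' F0' D) => //; first by rewrite sw sl.
- by apply: sub_all_in Kw => ? [].
- by apply: sub_all_in Kw => ? [].
Qed.

Lemma iter_sd_small (V : normedModType R) (A : comNzRingType) (K : set V) k n m e
    (F : seq V -> A) : (k <= n.+1)%N -> aff_closed K ->
  small_eq0 K k ((n%:R / n.+1%:R) ^+ m * e) F ->
  small_eq0 K k e (iter m (sd (@bar V)) F).
Proof.
move=> kn cK; elim: m e => [|m IH] e F0; first by rewrite mul1r in F0.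
by apply: (@sd_small _ _ _ _ n) => //; apply: IH; rewrite mulrA -exprSr.
Qed.

End Barycenter.

(** * Singular cochains *)

Section SingularSimplices.
Variables (R : realType) (A : comNzRingType).

(* Cochains are functions on the simplices of all dimensions at once, so that
   degree 0 needs no special treatment: there, coboundaries vanish. *)
Definition simplex (X : topologicalType) := {k : nat & singular_simplex R X k}.

Definition mk_simplex (X : topologicalType) k (s : singular_simplex R X k) :
  simplex X := existT _ k s.

Definition dd (X : topologicalType) (c : simplex X -> A) (s : simplex X) : A :=
  match s with
  | existT k s => match k return singular_simplex R X k -> A with
    | 0 => fun=> 0
    | k'.+1 => fun s => coboundary (fun s' => c (mk_simplex s')) s
    end s
  end.

(* The junk value 0 on discontinuous maps spares continuity proofs in [ev]. *)
Definition cval (X : topologicalType) (c : simplex X -> A) m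
    (w : std_simplex R m -> X) : A :=
  if pselect (continuous w) is left cw then c (mk_simplex (mkcts cw)) else 0.

Lemma cvalE (X : topologicalType) (c : simplex X -> A) m
    (s : singular_simplex R X m) (w : std_simplex R m -> X) :
  (forall x, s x = w x) -> cval c w = c (mk_simplex s).
Proof.
move=> /funext <-; rewrite /cval; case: pselect => [cs|[]]; last exact: cts_fun.
by congr (c (mk_simplex _)); apply/continuousEP.
Qed.

Definition ev (X : topologicalType) (V : lmodType R) (c : simplex X -> A)
    (u : V -> X) (l : seq V) : A :=
  if l is v :: l' then
    cval c (fun x : std_simplex R (size l') => u (affine_comb l (val x)))
  else 0.

Lemma evE (X : topologicalType) (V : lmodType R) (c : simplex X -> A)
    (u : V -> X) (l : seq V) m : size l = m.+1 ->
  ev c u l = cval c (fun x : std_simplex R m => u (affine_comb l (val x))).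
Proof. by case: l => // v l [<-]. Qed.

(** Continuity is tested along maps from standard simplices; this is all that evaluation on affine
    simplices requires. *)
Definition cont_on (X V : topologicalType) (K : set V) (u : V -> X) :=
  forall m (g : std_simplex R m -> V), continuous g -> (forall z, K (g z)) ->
    continuous (u \o g).

Lemma continuous_affine (V : normedModType R) (l : seq V) m :
  continuous (fun x : std_simplex R m => affine_comb l (val x)).
Proof.
rewrite /affine_comb => x; apply: cvg_big => [||j _]; [exact: add_continuous|exact: nbhs_filter|].
have cj : continuous ((fun M : 'rV[R]_m.+1 => M ord0 j) \o
    (set_val : std_simplex R m -> _)).
  move=> y; apply: continuous_comp; first exact: initial_continuous.
  exact: coord_continuous.
have := @continuous_comp _ _ _ _ (fun r : R => r *: nth 0 l j) x (cj x).
by apply; exact: scalel_continuous.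
Qed.

Lemma affine_comb_face (V : lmodType R) (l : seq V) m (i : 'I_m.+2)
    (x : 'rV[R]_m.+1) : size l = m.+2 ->
  affine_comb l (insert_zero i x) = affine_comb (take i l ++ drop i.+1 l) x.
Proof.
move=> sl; rewrite /affine_comb (bigD1_ord i) //= mxE unlift_none scale0r add0r.
apply: eq_bigr => j _; rewrite mxE liftK /=; congr (_ *: _).
rewrite nth_cat size_take sl ltn_ord /= /bump.
case: (ltnP j i) => ij; rewrite /= ?nth_take ?add0n //.
by rewrite nth_drop; congr nth; lia.
Qed.

(** The bridge from lists to singular simplices: deleting a vertex amounts to inserting a zero
    barycentric coordinate, so [ev] is a cochain map. For a single vertex both sides are 0, by the
    value of [ev] on the empty list and the convention on [dd] in degree 0. *)
Lemma lbd_ev (X : topologicalType) (V : normedModType R) (K : set V)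
    (c : simplex X -> A) (u : V -> X) l :
  aff_closed K -> cont_on K u -> all_in K l ->
  lbd (ev c u) l = ev (dd c) u l.
Proof.
move=> cK cu; case: l => [//|v [|v' l]] Kl.
  rewrite /= subr0 /cval; by case: pselect.
set l1 := v :: v' :: l in Kl *; have sl : size l1 = (size l).+2 by [].
have cw m l' : size l' = m.+1 -> all_in K l' ->
    continuous (fun x : std_simplex R m => u (affine_comb l' (val x))).
  move=> sl' Kl'; have := cu m _ (@continuous_affine V l' m); apply => z.
  by apply: cK => //; apply: set_mem (valP z).
rewrite (evE _ _ sl) (@cvalE _ _ _ (mkcts (cw _ _ sl Kl))) //.
rewrite lbd_sum sl; apply: eq_bigr => i _; congr (_ *~ _).
have sd : size (take i l1 ++ drop i.+1 l1) = (size l).+1.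
  by rewrite size_cat size_take size_drop sl ltn_ord; have := ltn_ord i; lia.
rewrite (evE _ _ sd); apply: cvalE => x /=.
by rewrite -affine_comb_face.
Qed.

Lemma ev0 (X : topologicalType) (V : lmodType R) (u : V -> X) l :
  ev (fun=> 0) u l = 0 :> A.
Proof. by case: l => //= v l; rewrite /cval; case: pselect. Qed.

Lemma eq_ev (X : topologicalType) (V : lmodType R) (K : set V)
    (c : simplex X -> A) (u u' : V -> X) l :
  aff_closed K -> (forall v, K v -> u v = u' v) -> all_in K l ->
  ev c u l = ev c u' l.
Proof.
move=> cK uu'; case: l => // v l Kl; rewrite /ev; congr cval; apply/funext => x.
by apply: uu'; apply: cK => //; apply: set_mem (valP x).
Qed.

Lemma ev_map (X : topologicalType) (V V' : lmodType R) (c : simplex X -> A)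
    (u : V' -> X) (f : V -> V') l : linear f ->
  ev c u (map f l) = ev c (u \o f) l.
Proof.
move=> lf; case: l => // v l; rewrite !(@evE _ _ _ _ _ (size l)) ?size_map //; congr cval.
apply/funext => x; congr u; rewrite /affine_comb.
have [f0 fD fZ] := linear_morph lf.
rewrite (big_morph f fD f0); apply: eq_bigr => j _; rewrite fZ.
by rewrite (nth_map 0 0 f (s := v :: l) (ltn_ord j)).
Qed.

Lemma aff_closed_simplex k : aff_closed (std_simplex R k).
Proof.
move=> l m x sl /(all_in_nth _ 0) al [x0 x1].
have xl i (j : 'I_m.+1) : (x ord0 j *: nth 0 l j) ord0 i =
    x ord0 j * (nth 0 l j) ord0 i by rewrite mxE.
have lK (j : 'I_m.+1) : std_simplex R k (nth 0 l j) by apply: al; rewrite sl.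
split=> [i|].
  rewrite /affine_comb summxE; apply: sumr_ge0 => j _; rewrite xl mulr_ge0 //.
  by have [al0 _] := lK j.
rewrite /affine_comb; under eq_bigr do rewrite summxE.
rewrite exchange_big /= -[RHS]x1; apply: eq_bigr => j _.
under eq_bigr do rewrite xl.
by rewrite -mulr_sumr; have [_ ->] := lK j; rewrite mulr1.
Qed.

Definition vertices k : seq 'rV[R]_k.+1 := [seq delta_mx 0 i | i <- enum 'I_k.+1].

Lemma size_vertices k : size (vertices k) = k.+1.
Proof. by rewrite size_map size_enum_ord. Qed.

Lemma affine_vertices k (x : 'rV[R]_k.+1) : affine_comb (vertices k) x = x.
Proof.
rewrite [RHS]row_sum_delta; apply: eq_bigr => j _; congr (_ *: _).
by rewrite (nth_map ord0) ?size_enum_ord // nth_ord_enum.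
Qed.

Lemma delta_simplex k (i : 'I_k.+1) : std_simplex R k (delta_mx 0 i).
Proof.
split=> [j|]; first by rewrite mxE ler0n.
rewrite (bigD1 i) //= mxE !eqxx big1 ?addr0 // => j ji.
by rewrite mxE (negbTE ji) andbF.
Qed.

Lemma all_in_vertices k : all_in (std_simplex R k) (vertices k).
Proof.
apply/(all_in_nth _ 0) => i; rewrite size_vertices => ik.
by rewrite (nth_map ord0) ?size_enum_ord //; apply: delta_simplex.
Qed.

Lemma linear_insert_zero k (i : 'I_k.+2) : linear (@insert_zero R k i).
Proof.
move=> a x y; apply/rowP => j; rewrite !mxE.
by case: unliftP => [j' _|_] /=; rewrite ?mxE // mulr0 addr0.
Qed.

Lemma vertices_face k (i : 'I_k.+2) :
  take i (vertices k.+1) ++ drop i.+1 (vertices k.+1) =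
  map (@insert_zero R k i) (vertices k).
Proof.
apply: (@eq_from_nth _ 0).
  rewrite size_cat size_take size_drop [RHS]size_map !size_vertices ltn_ord.
  by have := ltn_ord i; lia.
rewrite size_cat size_take size_drop !size_vertices ltn_ord => j jk.
have {}jk : (j < k.+1)%N by move: jk (ltn_ord i); lia.
pose j' := Ordinal jk.
have -> : nth 0 (take i (vertices k.+1) ++ drop i.+1 (vertices k.+1)) j =
    delta_mx 0 (lift i j').
  rewrite nth_cat size_take size_vertices ltn_ord.
  have lift0bump : nat_of_ord (lift i j') = ((i <= j) + j)%N by [].
  have nthv m : (m < k.+2)%N -> nth 0 (vertices k.+1) m = delta_mx 0 (inord m).
    move=> mk; rewrite (nth_map ord0) ?size_enum_ord //; congr delta_mx.
    by apply: val_inj; rewrite /= nth_enum_ord // inordK.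
  case: (ltnP j i) => ij.
    rewrite nth_take // nthv; last by move: (jk); lia.
    have jk2 : (j < k.+2)%N by apply: ltnW.
    congr (delta_mx 0 _); apply: ord_inj; rewrite inordK //.
    by rewrite lift0bump leqNgt ij.
  rewrite nth_drop nthv; last by move: (jk); lia.
  have -> : (i.+1 + (j - i) = j.+1)%N by rewrite addSn subnKC.
  congr (delta_mx 0 _); apply: ord_inj; rewrite inordK //.
  by rewrite lift0bump ij.
rewrite (nth_map 0) ?size_vertices // (nth_map ord0) ?size_enum_ord //.
have -> : nth ord0 (enum 'I_k.+1) j = j' by apply: ord_inj; rewrite nth_enum_ord.
apply/rowP => l; rewrite !mxE /=; case: unliftP => [l' ->|->] /=.
  by rewrite mxE (inj_eq lift_inj).
by rewrite (negbTE (neq_lift _ _)).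
Qed.

Section Extension.
Variables (X : topologicalType) (k : nat) (s : singular_simplex R X k).

Let vertex0 : std_simplex R k :=
  exist (fun x => x \in std_simplex R k) (delta_mx 0 ord0)
    (mem_set (delta_simplex ord0)).

(* An arbitrary extension of [s]: only its values on the simplex matter. *)
Definition extend (v : 'rV[R]_k.+1) : X :=
  s (if pselect (std_simplex R k v) is left Sv
     then exist (fun x => x \in std_simplex R k) v (mem_set Sv) else vertex0).

Lemma extendE (x : std_simplex R k) : extend (val x) = s x.
Proof.
rewrite /extend; case: pselect => [Sv|[]]; last exact: set_mem (valP x).
by congr (s _); apply: val_inj.
Qed.

Lemma extend_range v : exists x, extend v = s x.
Proof. by eexists. Qed.

Lemma extend_cont : cont_on (std_simplex R k) extend.
Proof.
move=> m g cg gS.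
pose g' z : std_simplex R k :=
  exist (fun x => x \in std_simplex R k) (g z) (mem_set (gS z)).
have cg' : continuous g' by apply: continuous_comp_initial.
have -> : extend \o g = s \o g'.
  by apply/funext => z; rewrite /= -[g z]/(val (g' z)) extendE.
by move=> z; apply: continuous_comp; [exact: cg' | exact: cts_fun].
Qed.

Lemma ev_vertices (c : simplex X -> A) :
  ev c extend (vertices k) = c (mk_simplex s).
Proof.
rewrite (evE _ _ (size_vertices k)); apply: cvalE => x.
by rewrite affine_vertices extendE.
Qed.

End Extension.

Lemma extend_face (X : topologicalType) k (s : singular_simplex R X k.+1)
    (i : 'I_k.+2) v : std_simplex R k v ->
  extend (s \o face R i) v = extend s (insert_zero i v).
Proof.
move=> Sv; pose x : std_simplex R k :=
  exist (fun x => x \in std_simplex R k) v (mem_set Sv).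
by rewrite -[v]/(val x) extendE -[insert_zero i _]/(val (face R i x)) extendE.
Qed.

Lemma dd_dd (X : topologicalType) (c : simplex X -> A) : dd (dd c) = fun=> 0.
Proof.
apply/funext => -[k s]; rewrite -/(mk_simplex s) -ev_vertices.
rewrite -(lbd_ev _ (@aff_closed_simplex k) (@extend_cont _ _ s) (all_in_vertices k)).
rewrite (lbd_ext (F' := lbd (ev c (extend s))) (all_in_vertices k)).
  by rewrite lbd_lbd.
move=> w _ Kw; symmetry.
exact: (lbd_ev _ (@aff_closed_simplex k) (@extend_cont _ _ s)).
Qed.

End SingularSimplices.

(** * Iterated subdivision of singular cochains *)

Section ChainOperators.
Variables (R : realType) (A : comNzRingType).

Lemma linear_pair_map (V V' : lmodType R) (f : V -> V') : linear f ->
  linear (fun z : V * R^o => (f z.1, z.2) : V' * R^o).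
Proof. by move=> lf a [x r] [y r']; rewrite /= lf. Qed.

Section Subdivide.
Variable V : normedModType R.
Implicit Types (F : seq V -> A) (K : set V).

Definition sd_hpt F l := hpt (@bar R V) (fun F l => F l - sd (@bar R V) F l) F l.

(** The telescoping homotopy between the identity and the [m]-fold subdivision. *)
Definition iter_hpt m F l := \sum_(j < m) sd_hpt (iter j (sd (@bar R V)) F) l.

Let PhiB F F' l : (F l - F' l) - sd (@bar R V) (fun w => F w - F' w) l =
  (F l - sd (@bar R V) F l) - (F' l - sd (@bar R V) F' l).
Proof. by rewrite sdB; ring. Qed.

Lemma sd_hptB F F' l :
  sd_hpt (fun w => F w - F' w) l = sd_hpt F l - sd_hpt F' l.
Proof. by apply: hptB => *; apply: PhiB. Qed.

Lemma iter_sdB m F F' : iter m (sd (@bar R V)) (fun w => F w - F' w) =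
  (fun w => iter m (sd (@bar R V)) F w - iter m (sd (@bar R V)) F' w).
Proof. by elim: m => //= m ->; apply/funext => w; rewrite sdB. Qed.

Lemma iter_sd_lbd m F : iter m (sd (@bar R V)) (lbd F) =
  lbd (iter m (sd (@bar R V)) F).
Proof. by elim: m => //= m ->; apply/funext => w; rewrite sd_lbd. Qed.

Lemma iter_hptB m F F' l :
  iter_hpt m (fun w => F w - F' w) l = iter_hpt m F l - iter_hpt m F' l.
Proof.
rewrite /iter_hpt -sumrB; apply: eq_bigr => j _.
by rewrite iter_sdB sd_hptB.
Qed.

Lemma iter_hpt_lbd m F l :
  iter_hpt m (lbd F) l + lbd (iter_hpt m F) l = F l - iter m (sd (@bar R V)) F l.
Proof.
elim: m => [|m IH].
  rewrite /iter_hpt big_ord0 add0r /= subrr (eq_lbd (F' := fun=> 0)) ?lbd0 //.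
  by move=> w _; rewrite big_ord0.
rewrite /iter_hpt big_ord_recr /= -/(iter_hpt m _ _).
rewrite (eq_lbd (F' := fun w => iter_hpt m F w -
  (0 - sd_hpt (iter m (sd (@bar R V)) F) w))); last first.
  by move=> w _; rewrite big_ord_recr /= sub0r opprK.
rewrite lbdB lbdB lbd0 iter_sd_lbd sub0r opprK.
have H : sd_hpt (lbd (iter m (sd (@bar R V)) F)) l +
    lbd (sd_hpt (iter m (sd (@bar R V)) F)) l =
    iter m (sd (@bar R V)) F l - iter m.+1 (sd (@bar R V)) F l.
  apply: hpt_lbd => [? ? ?|?|? ?]; rewrite ?subrr //.
  by rewrite lbdB sd_lbd.
by rewrite addrACA IH H /=; ring.
Qed.

Lemma iter_sd_eq0 K m F l : aff_closed K -> all_in K l ->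
  (forall w, size w = size l -> all_in K w -> F w = 0) ->
  iter m (sd (@bar R V)) F l = 0.
Proof.
move=> cK; elim: m l => [|m IH] l Kl F0 /=; first exact: F0.
apply: (sd_eq0 (K := K)) => //; first by move=> w; apply: bar_in.
by move=> w sw Kw; apply: IH => // w' sw'; apply: F0; rewrite sw' sw.
Qed.

Lemma sd_hpt_eq0 K F l : aff_closed K -> all_in K l ->
  (forall w, size w = (size l).+1 -> all_in K w -> F w = 0) -> sd_hpt F l = 0.
Proof.
move=> cK Kl F0; apply: (hpt_eq0 _ (K := K) (K' := K)) => //.
- by move=> G; rewrite subrr.
- by move=> w; apply: bar_in.
move=> G w Kw G0; rewrite G0 // (sd_eq0 (K := K)) ?subrr //.
by move=> ?; apply: bar_in.
Qed.

Lemma iter_hpt_eq0 K m F l : aff_closed K -> all_in K l ->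
  (forall w, size w = (size l).+1 -> all_in K w -> F w = 0) ->
  iter_hpt m F l = 0.
Proof.
move=> cK Kl F0; apply: big1 => j _; apply: (sd_hpt_eq0 cK) => // w sw Kw.
by apply: (iter_sd_eq0 _ cK) => // w' sw'; apply: F0; rewrite sw' sw.
Qed.

End Subdivide.

Lemma iter_hpt_map (V V' : normedModType R) (f : V -> V') m
    (F : seq V' -> A) l : linear f ->
  iter_hpt m F (map f l) = iter_hpt m (fun w => F (map f w)) l.
Proof.
move=> lf; apply: eq_bigr => j _.
have fb w : (0 < size w)%N -> bar (map f w) = f (bar w) by rewrite bar_map.
rewrite /sd_hpt (hpt_map (b := @bar R V) (g := f)
  (Phi := fun F l => F l - sd (@bar R V) F l)) //; last first.
  by move=> G w; rewrite (sd_map _ _ fb).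
congr hpt; elim: {l j}(val j) => //= j <-.
by apply/funext => w; rewrite (sd_map _ _ fb).
Qed.

Definition push (X Y : topologicalType) (t : continuousType X Y)
    (s : simplex R X) : simplex R Y :=
  let: existT k u := s in @mk_simplex R Y k (t \o (u : singular_simplex R X k)).

Variable X : topologicalType.
Implicit Types c : simplex R X -> A.

Lemma ev_eq0 (V : normedModType R) (K : set V) c (u : V -> X) l :
    aff_closed K -> all_in K l ->
    (forall m (w : singular_simplex R X m),
      (forall x, exists2 z, K z & w x = u z) -> c (mk_simplex w) = 0) ->
  ev c u l = 0.
Proof.
move=> cK; case: l => // v l Kl c0; rewrite /ev /cval; case: pselect => // cw.
apply: c0 => x; exists (affine_comb (v :: l) (val x)) => //.
by apply: cK => //; apply: set_mem (valP x).
Qed.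

Lemma evB (V : normedModType R) c c' (u : V -> X) l :
  ev (fun s => c s - c' s) u l = ev c u l - ev c' u l.
Proof.
case: l => [|v l]; first by rewrite /= subr0.
by rewrite /ev /cval; case: pselect => // _; rewrite subr0.
Qed.

(** Continuity of [u] matters here: [t \o u] might be continuous where [u] is not, and then only one
    side would take the junk value of [cval]. *)
Lemma ev_push (V : normedModType R) (K : set V) (t : continuousType X X) c
    (u : V -> X) l : aff_closed K -> cont_on R K u -> all_in K l ->
  ev (c \o push t) u l = ev c (t \o u) l.
Proof.
move=> cK cu; case: l => // v l Kl.
have cw : continuous (fun x : std_simplex R (size l) =>
    u (affine_comb (v :: l) (val x))).
  have := cu _ _ (@continuous_affine R V (v :: l) (size l)); apply => z.
  by apply: cK => //; apply: set_mem (valP z).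
rewrite /ev (@cvalE _ _ _ _ _ (mkcts cw)) //=.
by rewrite (@cvalE _ _ _ _ _ (t \o mkcts cw)) //.
Qed.

Lemma dd_vertices k (s : singular_simplex R X k.+1) c
    (F : seq 'rV[R]_k.+2 -> A) :
    (forall i : 'I_k.+2, c (mk_simplex (s \o face R i)) =
      F (map (@insert_zero R k i) (vertices R k))) ->
  dd c (mk_simplex s) = lbd F (vertices R k.+1).
Proof.
move=> cF; rewrite lbd_sum size_vertices; apply: eq_bigr => i _.
by rewrite cF vertices_face.
Qed.

(** This is the homotopy from the identity to the [m]-fold subdivision, not the subdivided cochain:
    its value on a simplex of dimension k involves [c] in dimension k+1. *)
Definition subdivide m c (s : simplex R X) : A :=
  let: existT k u := s in
  iter_hpt m (ev c (extend (u : singular_simplex R X k))) (vertices R k).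

Lemma ev_extend_face c k (s : singular_simplex R X k.+1) (i : 'I_k.+2) l :
  all_in (std_simplex R k) l ->
  ev c (extend (s \o face R i)) l = ev c (extend s) (map (@insert_zero R k i) l).
Proof.
move=> Kl; rewrite (ev_map _ _ _ (@linear_insert_zero R k i)).
apply: (eq_ev _ (@aff_closed_simplex R k)) => // v Sv.
by rewrite extend_face.
Qed.

(** The arbitrary extensions of [s] and of its face agree on the simplex only, so the two sides are
    compared through the carrier of the homotopy. *)
Lemma subdivide_face m c k (s : singular_simplex R X k.+1) (i : 'I_k.+2) :
  subdivide m c (mk_simplex (s \o face R i)) =
  iter_hpt m (ev c (extend s)) (map (@insert_zero R k i) (vertices R k)).
Proof.
rewrite (iter_hpt_map _ _ _ (@linear_insert_zero R k i)) /subdivide /=.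
apply/eqP; rewrite -subr_eq0 -iter_hptB; apply/eqP.
apply: (iter_hpt_eq0 _ (@aff_closed_simplex R k) (all_in_vertices R k)).
by move=> w _ Kw; rewrite ev_extend_face // subrr.
Qed.

Lemma subdivideB m c c' s :
  subdivide m (fun s => c s - c' s) s = subdivide m c s - subdivide m c' s.
Proof.
case: s => k s; rewrite /subdivide -iter_hptB; congr iter_hpt.
by apply/funext => l; rewrite evB.
Qed.

Lemma subdivide_push m (t : continuousType X X) c s :
  subdivide m c (push t s) = subdivide m (c \o push t) s.
Proof.
case: s => k s; rewrite /subdivide /=.
apply/eqP; rewrite -subr_eq0 -iter_hptB; apply/eqP.
apply: (iter_hpt_eq0 _ (@aff_closed_simplex R k) (all_in_vertices R k)).
move=> w _ Kw; rewrite (ev_push _ _ (@aff_closed_simplex R k)) //; last first.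
  exact: extend_cont.
by rewrite subrr.
Qed.

Lemma subdivide_eq0 m c k (s : singular_simplex R X k) :
    (forall n (w : singular_simplex R X n), (forall x, exists y, w x = s y) ->
      c (mk_simplex w) = 0) ->
  subdivide m c (mk_simplex s) = 0.
Proof.
move=> c0; apply: (iter_hpt_eq0 _ (@aff_closed_simplex R k) (all_in_vertices R k)).
move=> w _ Kw; apply: (ev_eq0 (@aff_closed_simplex R k)) => // n u us.
apply: c0 => x; have [z _ ->] := us x; exact: extend_range.
Qed.

End ChainOperators.

(** * Cocycles that vanish on small simplices *)

Section SmallSimplices.
Variables (R : realType) (A : comNzRingType) (X : topologicalType).

Lemma row_norm_le n (x : 'rV[R]_n) r : 0 <= r ->
  (forall j, `|x ord0 j| <= r) -> `|x| <= r.
Proof.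
move=> r0 xr; rewrite /Num.norm /= mx_normrE; apply: bigmax_le => // -[i j] _ /=.
by rewrite (ord1 i); apply: xr.
Qed.

Lemma diam_simplex k : diam_le (std_simplex R k) 1.
Proof.
move=> x y [x0 x1] [y0 y1].
have le1 (z : 'rV[R]_k.+1) j : (forall j, 0 <= z ord0 j) ->
    \sum_j z ord0 j = 1 -> z ord0 j <= 1.
  by move=> z0 <-; rewrite (bigD1 j) //= lerDl sumr_ge0.
apply: row_norm_le => // j; rewrite !mxE ler_norml.
have := le1 x j x0 x1; have := le1 y j y0 y1; have := x0 j; have := y0 j.
by move=> ? ? ? ?; apply/andP; split; lra.
Qed.

Lemma iter_sd_vanish k n e (F : seq 'rV[R]_k.+1 -> A) : 0 < e ->
    (forall k', small_eq0 (std_simplex R k) k' e F) ->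
  exists m0, forall m, (m0 <= m)%N -> forall l, (size l <= n.+1)%N ->
    all_in (std_simplex R k) l -> iter m (sd (@bar R 'rV[R]_k.+1)) F l = 0.
Proof.
move=> e0 F0; pose q : R := n%:R / n.+1%:R.
have q0 : 0 <= q by rewrite divr_ge0.
have q1 : q < 1 by rewrite ltr_pdivrMr ?ltr0n // mul1r ltr_nat.
have [m0 qm] : exists m0, forall m, (m0 <= m)%N -> q ^+ m <= e.
  have /cvgrPdist_le/(_ e e0)[m0 _ H] : (q ^+ m) @[m --> \oo] --> 0.
    by apply: cvg_expr; rewrite ger0_norm.
  exists m0 => m mm; have := H m mm.
  by rewrite /= sub0r normrN ger0_norm // exprn_ge0.
exists m0 => m mm l sl Kl.
apply: (@iter_sd_small R _ A (std_simplex R k) (size l) n m 1 F sl _ _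
  (std_simplex R k)) => //.
- exact: aff_closed_simplex.
- rewrite mulr1 => D w sw Kw Dq Dw; apply: (F0 _ D) => // x y Dx Dy.
  exact: le_trans (Dq _ _ Dx Dy) (qm _ mm).
- exact: diam_simplex.
Qed.

Lemma iter_hpt_nil (V : normedModType R) m (F : seq V -> A) :
  iter_hpt m F [::] = 0.
Proof. by apply: big1. Qed.

(* The number of subdivisions depends on the simplex, but further subdivisions do
   not change the value of [b], so that common numbers can be used for a simplex
   and its faces. *)
Lemma small_simplices (P : set (simplex R X)) (c : simplex R X -> A) :
    (forall k (s : singular_simplex R X k.+1) (i : 'I_k.+2),
      P (mk_simplex s) -> P (mk_simplex (s \o face R i))) ->
    dd c = (fun=> 0) ->
    (forall k (s : singular_simplex R X k), P (mk_simplex s) ->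
      exists2 e, 0 < e &
        forall k', small_eq0 (std_simplex R k) k' e (ev c (extend s))) ->
  exists b : simplex R X -> A,
    [/\ forall s, P s -> dd b s = c s,
        forall s, ~ P s -> b s = 0
      & forall s, P s -> exists m0, forall m, (m0 <= m)%N ->
          b s = subdivide m c s].
Proof.
move=> Pface dc c_small.
have stable (s : simplex R X) : exists m0, P s -> forall m, (m0 <= m)%N ->
    subdivide m c s = subdivide m0 c s /\
    iter m (sd (@bar R _)) (ev c (extend (projT2 s)))
      (vertices R (projT1 s)) = 0.
  have [Ps|nP] := pselect (P s); last by exists 0%N.
  case: s Ps => k s Ps; have [e e0 se] := c_small _ s Ps.
  (* With [k.+1] the bound covers lists of k+2 points: besides the k+1 vertices of [s], these are
     the lists evaluated by the homotopy, whose later summands therefore vanish. *)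
  have [m0 H] := iter_sd_vanish k.+1 e0 se; exists m0 => _ m mm; split; last first.
    by apply: H => //; [rewrite size_vertices|apply: all_in_vertices].
  rewrite /subdivide /=; elim: m mm => [|m IH].
    by rewrite leqn0 => /eqP ->.
  rewrite leq_eqVlt => /orP[/eqP -> //|mm]; rewrite -IH //.
  rewrite /iter_hpt big_ord_recr /= -/(iter_hpt m _ _).
  rewrite (@sd_hpt_eq0 R A _ (std_simplex R k)) ?addr0 //.
  - exact: aff_closed_simplex.
  - exact: all_in_vertices.
  by move=> w sw Kw; apply: H => //; rewrite sw size_vertices.
have /choice[m0 m0P] := stable.
pose b s := if pselect (P s) then subdivide (m0 s) c s else 0.
have bE s m : P s -> (m0 s <= m)%N -> b s = subdivide m c s.
  by move=> Ps mm; rewrite /b; case: pselect => //= _; have [-> _] := m0P s Ps m mm.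
exists b; split=> [s Ps|s nP|s Ps].
- case: s Ps => k s Ps.
  (* In the homotopy formula the term with the coboundary of [c] is 0, as [c] is a cocycle, and the
     subdivided [c] vanishes on [s]. *)
  have F0 : forall m, (m0 (mk_simplex s) <= m)%N ->
      c (mk_simplex s) = lbd (iter_hpt m (ev c (extend s))) (vertices R k).
    move=> m mm; have [_] := m0P _ Ps m mm; rewrite [projT1 _]/= [projT2 _]/= => E.
    have := iter_hpt_lbd m (ev c (extend s)) (vertices R k); rewrite E subr0 ev_vertices => <-.
    rewrite (iter_hpt_eq0 _ (@aff_closed_simplex R k) (all_in_vertices R k)).
      by rewrite add0r.
    move=> w _ Kw; rewrite (lbd_ev _ (@aff_closed_simplex R k)) //.
      by rewrite dc ev0.
    exact: extend_cont.
  case: k s Ps F0 => [|k] s Ps F0.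
    rewrite (F0 _ (leqnn _)) (_ : vertices R 0 = [:: delta_mx 0 ord0]); last first.
      by rewrite /vertices enum_ordSl enum_ord0.
    by rewrite /= iter_hpt_nil
 subr0.
  pose M := maxn (m0 (mk_simplex s))
    (\max_(i < k.+2) m0 (mk_simplex (s \o face R i))).
  rewrite (F0 M) ?leq_maxl //; apply: dd_vertices => i.
  rewrite (bE _ M) ?subdivide_face //; first exact: Pface.
  by rewrite leq_max; apply/orP; right; apply: (leq_bigmax (F := fun i : 'I_k.+2 => m0 (mk_simplex (s \o face R i))) i).
- by rewrite /b; case: pselect.
- by exists (m0 s) => m mm; apply: bE.
Qed.

End SmallSimplices.

Section Lebesgue.
Variables (R : realType) (A : comNzRingType) (X : topologicalType).

Lemma continuous_sumr (T : topologicalType) n (f : 'I_n -> T -> R) :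
  (forall j, continuous (f j)) -> continuous (fun x => \sum_j f j x).
Proof.
move=> cf x; apply: cvg_big => [|j _]; first exact: add_continuous.
exact: cf.
Qed.

Lemma simplex_compact k : compact (std_simplex R k).
Proof.
apply: bounded_closed_compact.
  exists 1; split=> // M M1 x [x0 x1]; apply: le_trans (ltW M1).
  apply: row_norm_le => // j; rewrite ger0_norm // -x1 (bigD1 j) //= lerDl.
  exact: sumr_ge0.
have -> : std_simplex R k = (\bigcap_j [set x : 'rV[R]_k.+1 | 0 <= x ord0 j]) `&`
    [set x : 'rV[R]_k.+1 | \sum_j x ord0 j = 1].
  by apply/seteqP; split=> x [x0 x1]; split => // j *; apply: x0.
apply: closedI.
  apply: closed_bigI => j _.
  have /continuous_closedP := @coord_continuous R 1 k.+1 ord0 j.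
  by move=> /(_ _ (@closed_ge R 0)).
have : continuous (fun x : 'rV[R]_k.+1 => \sum_j x ord0 j).
  by apply: continuous_sumr => j; apply: coord_continuous.
by move=> /continuous_closedP/(_ _ (@closed_eq R 1)).
Qed.

Lemma lebesgue_number k (s : singular_simplex R X k) (U : set (set X)) :
    (forall V, U V -> open V) -> (forall x, exists2 V, U V & V (s x)) ->
  exists2 e, 0 < e & forall x : std_simplex R k, exists2 V, U V &
    forall y : std_simplex R k, `|val x - val y| <= e -> V (s y).
Proof.
move=> Uo Uc.
pose good (e : R) (x : 'rV[R]_k.+1) := exists2 V, U V &
  forall y : std_simplex R k, `|x - val y| <= e -> V (s y).
have ngood x : std_simplex R k x -> \forall x' \near x & e \near (0 : R)^'+, good e x'.
  move=> Sx; pose x1 : std_simplex R k := exist (fun x => x \in std_simplex R k) x (mem_set Sx).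
  have [V UV Vx] := Uc x1.
  have [W oW WV] : open (s @^-1` V).
    by have /continuousP := @cts_fun _ _ s; apply; apply: Uo.
  have Wx : W x by have : (set_val @^-1` W) x1 by rewrite WV.
  have /nbhs_ballP[d d0 dW] : nbhs x W by apply: open_nbhs_nbhs.
  (* Half for the move of the center and half for the radius, so that the ball around [x'] stays
     inside the one of radius [d] around [x]. *)
  exists (ball x (d / 2), [set e | e < d / 2]).
    split; first by apply: nbhsx_ballx; rewrite divr_gt0.
    by apply: nbhs_right_lt; rewrite divr_gt0.
  move=> [x' e] [/= xx' ed]; exists V => // y x'y.
  have : (set_val @^-1` W) y; last by rewrite WV.
  apply: dW; rewrite -ball_normE /= [d]splitr.
  have {}xx' : `|x - x'| < d / 2 by move: xx'; rewrite -ball_normE.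
  apply: le_lt_trans (_ : `|x - x'| + `|x' - val y| < _).
    by rewrite -(subrKA x') ler_normD.
  by apply: ltrD => //; apply: le_lt_trans ed.
have /compact_near_coveringP := @simplex_compact k.
move=> /(_ R ((0 : R)^'+) good _ ngood) ng.
have : \forall e \near (0 : R)^'+, 0 < e /\ (std_simplex R k `<=` good e).
  near=> e; split; first by near: e; apply: nbhs_right_gt.
  by near: e.
move=> /filter_ex[e [e0 ge]]; exists e => // x.
by apply: ge; apply: set_mem (valP x).
Unshelve. all: by end_near.
Qed.

Lemma small_cover (c : simplex R X -> A) k (s : singular_simplex R X k)
    (U : set (set X)) :
    (forall V, U V -> open V) -> (forall x, exists2 V, U V & V (s x)) ->
    (forall V n (w : singular_simplex R X n), U V -> (forall x, V (w x)) ->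
      (forall x, exists y, w x = s y) -> c (mk_simplex w) = 0) ->
  exists2 e, 0 < e &
    forall k', small_eq0 (std_simplex R k) k' e (ev c (extend s)).
Proof.
move=> Uo Uc c0; have [e e0 H] := lebesgue_number Uo Uc; exists e => // k' D l _.
case: l => // v l Kl De Dl; have [Kv _] := Kl; have [Dv _] := Dl.
have [V UV sV] := H (exist _ v (mem_set Kv) : std_simplex R k).
(* A list of diameter at most [e] lies in the ball around its first vertex; the ball is convex,
   hence contains the affine simplex that the list spans. *)
apply: (ev_eq0 (K := std_simplex R k `&` [set w | `|v - w| <= e])).
- by apply: aff_closedI; [exact: aff_closed_simplex|exact: aff_closed_ball].
- by apply: all_inI => //; apply: sub_all_in Dl => w Dw; apply: De.
move=> m w wE; apply: (c0 V) => // x; have [z [Kz vz] ->] := wE x.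
  pose z' : std_simplex R k := exist (fun x => x \in std_simplex R k) z (mem_set Kz).
  by rewrite -[z]/(val z') extendE; apply: sV.
exact: extend_range.
Qed.

End Lebesgue.

(** * Prism operators of homotopies *)

Section Prism.
Variables (R : realType) (A : comNzRingType).

Lemma affine_comb_pair (V W : lmodType R) (l : seq (V * W)) m (x : 'rV[R]_m.+1) :
  affine_comb l x =
  (affine_comb (map fst l) x, affine_comb (map snd l) x) :> V * W.
Proof.
rewrite /affine_comb; pose D (z1 z2 : V * W) := (z1.1 + z2.1, z1.2 + z2.2).
have e (j : 'I_m.+1) : x ord0 j *: nth 0 l j =
    (x ord0 j *: nth 0 (map fst l) j, x ord0 j *: nth 0 (map snd l) j) :> V * W.
  have [jl|jl] := ltnP j (size l); first by rewrite !(nth_map 0).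
  by rewrite !nth_default ?size_map.
rewrite (eq_bigr _ (fun j _ => e j)).
by elim/big_rec3: _ => // j y1 y2 y3 _ ->.
Qed.

Lemma aff_closed_pair (V W : lmodType R) (K : set V) (L : set W) :
  aff_closed K -> aff_closed L ->
  aff_closed ([set z | K z.1 /\ L z.2] : set (V * W)%type).
Proof.
move=> cK cL l m x sl Kl Sx; rewrite affine_comb_pair; split.
  by apply: cK; rewrite ?size_map //; apply: all_in_map Kl => ? [].
by apply: cL; rewrite ?size_map //; apply: all_in_map Kl => ? [].
Qed.

Lemma aff_closed_itv : aff_closed ([set r | 0 <= r <= 1] : set R^o).
Proof.
move=> l m x sl /(all_in_nth _ 0) Il [x0 x1].
have lI (j : 'I_m.+1) : 0 <= nth 0 l j <= 1 by apply: Il; rewrite sl.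
apply/andP; split.
  by apply: sumr_ge0 => j _; apply: mulr_ge0 => //; have /andP[] := lI j.
rewrite -x1; apply: ler_sum => j _; rewrite -[leRHS]mulr1.
by apply: ler_wpM2l => //; have /andP[] := lI j.
Qed.

Definition cylinder k : set ('rV[R]_k.+1 * R^o) :=
  [set z | std_simplex R k z.1 /\ 0 <= z.2 <= 1].

Lemma aff_closed_cylinder k : aff_closed (@cylinder k).
Proof. exact: aff_closed_pair (@aff_closed_simplex R k) aff_closed_itv. Qed.

Lemma affine_comb_level (V : lmodType R) (l : seq V) (r : R) m
    (x : 'rV[R]_m.+1) : size l = m.+1 -> std_simplex R m x ->
  affine_comb [seq (v, r : R^o) | v <- l] x = (affine_comb l x, r : R^o).
Proof.
move=> sl [_ x1]; rewrite affine_comb_pair -!map_comp map_id; congr (_, _).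
rewrite /affine_comb (eq_bigr (fun j => x ord0 j * r)) => [|j _].
  by rewrite -mulr_suml x1 mul1r.
by congr (_ * _); rewrite (nth_map 0) // sl.
Qed.

(** The prism comes from acyclic models as well, with top minus bottom as the chain map. The apex
    has only to lie in the convex cylinder and to be natural under linear maps; the barycenter at
    level 0 is both. *)
Definition prism_op (V : normedModType R) (F : seq (V * R^o) -> A)
    (l : seq V) : A :=
  hpt (fun l => (bar l, 0))
    (fun F l => F [seq (v, 1) | v <- l] - F [seq (v, 0) | v <- l]) F l.

Lemma prism_opB (V : normedModType R) (F F' : seq (V * R^o) -> A) l :
  prism_op (fun w => F w - F' w) l = prism_op F l - prism_op F' l.
Proof. by apply: hptB => *; ring. Qed.

Lemma prism_op_lbd (V : normedModType R) (F : seq (V * R^o) -> A) l :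
  prism_op (lbd F) l + lbd (prism_op F) l =
  F [seq (v, 1) | v <- l] - F [seq (v, 0) | v <- l].
Proof.
apply: hpt_lbd => [? ? ?|?|? ?]; rewrite /= ?subrr //; first by ring.
by rewrite lbdB !lbd_map.
Qed.

Lemma prism_op_eq0 k (F : seq ('rV[R]_k.+1 * R^o) -> A) l :
  all_in (std_simplex R k) l ->
  (forall w, all_in (@cylinder k) w -> F w = 0) -> prism_op F l = 0.
Proof.
move=> Kl F0.
apply: (hpt_eq0 _ (K := std_simplex R k) (K' := @cylinder k)) => //.
- by move=> G; rewrite subrr.
- move=> w w0 Kw; split; last by rewrite /= lexx ler01.
  by apply: bar_in => //; apply: aff_closed_simplex.
- move=> G w Kw G0; rewrite !G0 ?subrr ?size_map //;
    by apply: all_in_map Kw => v Sv; split; rewrite //= ?lexx ler01.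
- by move=> w _; apply: F0.
Qed.

Lemma prism_op_map (V V' : normedModType R) (f : V -> V')
    (F : seq (V' * R^o) -> A) l : linear f ->
  prism_op F (map f l) =
  prism_op (fun w => F (map (fun z => (f z.1, z.2)) w)) l.
Proof.
move=> lf; apply: hpt_map => [w _|G w]; first by rewrite bar_map.
by rewrite -!map_comp.
Qed.

Variables (X : topologicalType) (H : X -> R -> X) (Y : set X).
(** Nothing is assumed about [H] outside [Y], and inside only continuity along simplices. *)
Hypothesis H_cont : forall m (g : std_simplex R m -> X) (r : std_simplex R m -> R),
  continuous g -> continuous r -> (forall z, Y (g z)) ->
  (forall z, 0 <= r z <= 1) -> continuous (fun z => H (g z) (r z)).
Implicit Types c : simplex R X -> A.

Definition sweep k (s : singular_simplex R X k) (z : 'rV[R]_k.+1 * R^o) : X :=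
  H (extend s z.1) z.2.

Lemma sweep_cont k (s : singular_simplex R X k) : (forall x, Y (s x)) ->
  cont_on R (@cylinder k) (sweep s).
Proof.
move=> Ys m g cg gK; apply: H_cont.
- apply: (extend_cont (g := fst \o g)) => [x|x]; last by have [] := gK x.
  have := cvg_comp _ _ (cg x); apply; exact: cvg_fst.
- by move=> x; have := cvg_comp _ _ (cg x); apply; exact: cvg_snd.
- by move=> x; have [y ->] := extend_range s (g x).1; apply: Ys.
- by move=> x; have [] := gK x.
Qed.

Definition prism c (s : simplex R X) : A :=
  let: existT k u := s in
  prism_op (ev c (sweep (u : singular_simplex R X k))) (vertices R k).

Lemma prism_face c k (s : singular_simplex R X k.+1) (i : 'I_k.+2) :
  prism c (mk_simplex (s \o face R i)) =
  prism_op (ev c (sweep s)) (map (@insert_zero R k i) (vertices R k)).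
Proof.
rewrite (prism_op_map _ _ (@linear_insert_zero R k i)) /prism /=.
apply/eqP; rewrite -subr_eq0 -prism_opB; apply/eqP.
apply: prism_op_eq0 => [|w Kw]; first exact: all_in_vertices.
rewrite (ev_map _ _ _ (linear_pair_map (@linear_insert_zero R k i))).
rewrite (eq_ev _ (@aff_closed_cylinder k) (u' := sweep s \o
  (fun z => (insert_zero i z.1, z.2)))) ?subrr //.
by move=> z [Sz _]; rewrite /sweep extend_face.
Qed.

Lemma prismB c c' s :
  prism (fun s => c s - c' s) s = prism c s - prism c' s.
Proof.
case: s => k s; rewrite /prism -prism_opB; congr prism_op.
by apply/funext => l; rewrite evB.
Qed.

Lemma prism_eq0 c k (s : singular_simplex R X k) :
    (forall n (w : singular_simplex R X n),
      (forall x, exists y r, 0 <= r <= 1 /\ w x = H (s y) r) ->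
      c (mk_simplex w) = 0) ->
  prism c (mk_simplex s) = 0.
Proof.
move=> c0; apply: prism_op_eq0 => [|w Kw]; first exact: all_in_vertices.
apply: (ev_eq0 (@aff_closed_cylinder k)) => // n u us.
apply: c0 => x; have [z [_ z2] ->] := us x.
by have [y e] := extend_range s z.1; exists y, z.2; rewrite /sweep e.
Qed.

Lemma prism_push (t : continuousType X X) c k (s : singular_simplex R X k) :
    (forall y r, Y y -> H (t y) r = t (H y r)) -> (forall x, Y (s x)) ->
  prism c (push t (mk_simplex s)) = prism (c \o push t) (mk_simplex s).
Proof.
move=> Ht Ys; rewrite /prism /=.
apply/eqP; rewrite -subr_eq0 -prism_opB; apply/eqP.
apply: prism_op_eq0 => [|w Kw]; first exact: all_in_vertices.
rewrite (ev_push _ _ (@aff_closed_cylinder k) (sweep_cont Ys)) //.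
suff -> : sweep (t \o s) = t \o sweep s by rewrite subrr.
apply/funext => z; rewrite /sweep /= -Ht; last first.
  by have [y ->] := extend_range s z.1; apply: Ys.
by rewrite /extend; case: pselect.
Qed.

Lemma prism_homotopy c k (s : singular_simplex R X k) :
    dd c = (fun=> 0) -> (forall x, Y (s x)) ->
  dd (prism c) (mk_simplex s) =
  cval c (fun x => H (s x) 1) - cval c (fun x => H (s x) 0).
Proof.
move=> dc Ys.
have -> : dd (prism c) (mk_simplex s) =
    lbd (prism_op (ev c (sweep s))) (vertices R k).
  case: k s Ys => [|k] s Ys; last by apply: dd_vertices => i; apply: prism_face.
  rewrite (_ : vertices R 0 = [:: delta_mx 0 ord0]); last first.
    by rewrite /vertices enum_ordSl enum_ord0.
  by rewrite /= subr0.
have := prism_op_lbd (ev c (sweep s)) (vertices R k).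
rewrite [X in X + _]prism_op_eq0 ?add0r; last first.
- move=> w Kw; rewrite (lbd_ev _ (@aff_closed_cylinder k)) //.
    by rewrite dc ev0.
  exact: sweep_cont.
- exact: all_in_vertices.
have evl r : ev c (sweep s) [seq (v, r : R^o) | v <- vertices R k] =
    cval c (fun x => H (s x) r).
  rewrite (@evE _ _ _ _ _ _ _ k) ?size_map -?enumT ?size_enum_ord //.
  congr (cval c _); apply/funext => x.
  have Sx := set_mem (valP x).
  by rewrite affine_comb_level ?size_vertices // affine_vertices /sweep /= extendE.
by rewrite !evl.
Qed.

End Prism.

(** * Smith theory of a single space *)

Section Smith.
Variables (R : realType) (X : topologicalType) (p : nat).
Variable t : continuousType X X.
Hypotheses (p_pr : prime p) (tp : forall x, iter p t x = x).

Local Notation Om := (simplex R X).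
Local Notation Fp := 'F_p.
Implicit Types (c a e : Om -> Fp) (s : Om).

Definition lies_in (Y : set X) s : Prop :=
  let: existT k u := s in forall x, Y ((u : singular_simplex R X k) x).

Lemma simplex_eq k (u v : singular_simplex R X k) : (forall x, u x = v x) ->
  mk_simplex u = mk_simplex v.
Proof. by move=> uv; congr mk_simplex; apply/continuousEP. Qed.

Lemma iter_push n k (u : singular_simplex R X k) :
  exists2 v : singular_simplex R X k, iter n (push t) (mk_simplex u) = mk_simplex v &
    forall x, v x = iter n t (u x).
Proof.
elim: n => [|n [v e vE]]; first by exists u.
by exists (t \o v) => [|x]; rewrite /= ?e ?vE.
Qed.

Lemma iter_push_p s : iter p (push t) s = s.
Proof.
case: s => k u; have [v -> vE] := iter_push p u.
by apply: simplex_eq => x; rewrite vE tp.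
Qed.

Lemma lies_in_push (Y : set X) s : (forall x, Y x -> Y (t x)) ->
  lies_in Y s -> lies_in Y (push t s).
Proof. by case: s => k u tY uY x; apply: tY. Qed.

Lemma lies_in_iter (Y : set X) n s : (forall x, Y x -> Y (t x)) ->
  lies_in Y s -> lies_in Y (iter n (push t) s).
Proof. by move=> tY sY; elim: n => //= n IH; apply: lies_in_push. Qed.

Lemma lies_in_sub (Y Z : set X) s : Y `<=` Z -> lies_in Y s -> lies_in Z s.
Proof. by case: s => k u YZ uY x; apply: YZ. Qed.

Lemma lies_in_face (Y : set X) k (u : singular_simplex R X k.+1) (i : 'I_k.+2) :
  lies_in Y (mk_simplex u) -> lies_in Y (mk_simplex (u \o face R i)).
Proof. by move=> uY x; apply: uY. Qed.

Lemma dd_lin c c' s : dd (fun s => c s + c' s) s = dd c s + dd c' s.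
Proof.
case: s => -[|k] u /=; first by rewrite addr0.
by rewrite /coboundary -big_split; apply: eq_bigr => i _; rewrite mulrzDl.
Qed.

Lemma dd0 : dd (fun=> 0) = (fun=> 0) :> (Om -> Fp).
Proof. by apply/funext => -[[|k] u] //=; apply: big1 => l _; exact: mul0rz. Qed.

Lemma ddN c s : dd (fun s => - c s) s = - dd c s.
Proof.
case: s => -[|k] u /=; first by rewrite oppr0.
by rewrite /coboundary -sumrN; apply: eq_bigr => i _; rewrite mulNrz.
Qed.

Lemma dd_sum (c_ : nat -> Om -> Fp) (r1 r2 : nat) s :
  dd (fun s => \sum_(r1 <= i < r2) c_ i s) s = \sum_(r1 <= i < r2) dd (c_ i) s.
Proof.
case: s => -[|k] u /=; first by rewrite big1.
rewrite /coboundary exchange_big /=; apply: eq_bigr => i _.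
by rewrite -mulrz_suml.
Qed.

Lemma dd_eq0 (P : Om -> Prop) c s :
    (forall k (u : singular_simplex R X k.+1) i, P (mk_simplex u) ->
      P (mk_simplex (u \o face R i))) ->
  (forall s, P s -> c s = 0) -> P s -> dd c s = 0.
Proof.
move=> Pf c0; case: s => -[|k] u Pu //=; apply: big1 => i _.
by rewrite c0 ?mul0rz //; apply: Pf.
Qed.

Lemma dd_push c s : dd (c \o push t) s = dd c (push t s).
Proof.
case: s => -[|k] u //=; apply: eq_bigr => i _; congr (c _ *~ _).
exact: simplex_eq.
Qed.

Lemma dd_iter_push c n s :
  dd (fun s => c (iter n (push t) s)) s = dd c (iter n (push t) s).
Proof.
elim: n c s => [|n IH] c s //=.
rewrite -dd_push -IH; congr (dd _ s).
Qed.

Local Notation rho := (rho (p := p) (push t)).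

Lemma dd_rho b c s : dd (rho b c) s = rho b (dd c) s.
Proof.
case: b; rewrite /rho /=.
  rewrite -(big_mkord xpredT (fun i => dd c (iter i (push t) s))).
  under [RHS]eq_bigr => i _ do rewrite -dd_iter_push.
  rewrite -dd_sum; congr (dd _ s); apply/funext => s'.
  by rewrite big_mkord.
by rewrite (dd_lin c (fun s => - c (push t s))) ddN -[in RHS]dd_push.
Qed.

Lemma rhoD b c c' s : rho b (fun s => c s + c' s) s = rho b c s + rho b c' s.
Proof.
by case: b; rewrite /rho /=; [rewrite big_split | rewrite opprD addrACA].
Qed.

Lemma rhoN b c s : rho b (fun s => - c s) s = - rho b c s.
Proof.
by case: b; rewrite /rho /=; [rewrite sumrN | rewrite opprD].
Qed.

Definition fixedpts : set X := [set x | t x = x].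

(* The cochains of Smith's special cohomology: as a complex, [special b] is the
   image of [rho (~~ b)] on the cochains vanishing on [Y], if [Y] contains the
   fixed points. *)
Definition special b (Y : set X) c : Prop :=
  (forall s, lies_in Y s -> c s = 0) /\ (forall s, rho b c s = 0).

Lemma specialD b Y c c' : special b Y c -> special b Y c' ->
  special b Y (fun s => c s + c' s).
Proof.
move=> [c0 rc] [c'0 rc']; split=> s; last by rewrite rhoD rc rc' addr0.
by move=> sY; rewrite c0 // c'0 // addr0.
Qed.

Lemma specialN b Y c : special b Y c -> special b Y (fun s => - c s).
Proof.
move=> [c0 rc]; split=> s; last by rewrite rhoN rc oppr0.
by move=> sY; rewrite c0 // oppr0.
Qed.

Lemma special_dd b Y c : special b Y c -> special b Y (dd c).
Proof.
move=> [c0 rc]; split=> s; last first.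
  rewrite -dd_rho; apply: (dd_eq0 (P := fun=> True)) => // s' _; exact: rc.
move=> sY; apply: (dd_eq0 (P := lies_in Y)) => // k u i; exact: lies_in_face.
Qed.

Lemma special_sub b Y Z c : Z `<=` Y -> special b Y c -> special b Z c.
Proof.
by move=> ZY [c0 rc]; split => // s sZ; apply: c0; apply: lies_in_sub sZ.
Qed.

(* [dead m b c]: the class of [c] is killed by [m] successive connecting maps of
   the short exact sequences
   [0 -> special (~~ b) -> cochains -> special b -> 0] relative to the fixed
   points. *)
Fixpoint dead m b c : Prop :=
  if m is m'.+1 then
    exists a, [/\ forall s, lies_in fixedpts s -> a s = 0,
      forall s, c s = rho (~~ b) a s & dead m' (~~ b) (dd a)]
  else exists2 e, special b fixedpts e & forall s, c s = dd e s.

Lemma push_fixedP s : push t s = s <-> lies_in fixedpts s.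
Proof.
case: s => k u; split => [e x|uF]; last by apply: simplex_eq => x /=; apply: uF.
have e2 : (t \o u : singular_simplex R X k) = u by apply: existT_inj2 e.
by rewrite /fixedpts /= -[in RHS]e2.
Qed.

Lemma lies_in_nonempty (Y : set X) s : lies_in Y s -> exists x, Y x.
Proof.
case: s => k u uY; have x : std_simplex R k.
  by exists (delta_mx 0 ord0); apply: mem_set; apply: delta_simplex.
by exists ((u : singular_simplex R X k) x); apply: uY.
Qed.

(** The orbit indices of a simplex and of its faces are unrelated in general, so [rho_lift] is not a
    cochain map; it behaves like one wherever these indices agree. *)
Lemma dd_rho_lift idx b c k (u : singular_simplex R X k.+1) :
  (forall i : 'I_k.+2, idx (mk_simplex (u \o face R i)) = idx (mk_simplex u)) ->
  dd (rho_lift (push t) idx b c) (mk_simplex u) =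
  rho_lift (push t) idx b (dd c) (mk_simplex u).
Proof.
(* [c'] is the lift with the index frozen at that of [u], hence a fixed linear combination of
   translates of [c]. *)
move=> e; pose c' s := if b then if idx (mk_simplex u) == 0%N then c s else 0
  else - \sum_(p - idx (mk_simplex u) <= l < p) c (iter l (push t) s).
have -> : dd (rho_lift (push t) idx b c) (mk_simplex u) = dd c' (mk_simplex u).
  by apply: eq_bigr => i _; congr (_ *~ _); rewrite /rho_lift e.
rewrite /c' /rho_lift; case: b {c'}.
  by case: eqP => // _; apply: big1 => i _; rewrite mul0rz.
rewrite ddN dd_sum; congr (- _); apply: eq_bigr => l _; exact: dd_iter_push.
Qed.

(** Exactness of the Smith sequence at its right end: simplices outside [Y] are not fixed and have
    free orbits. Any choice of representatives will do, so the preferred set is empty. *)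
Lemma special_lift b Y c : fixedpts `<=` Y -> (forall x, Y x -> Y (t x)) ->
  special b Y c -> exists a, (forall s, lies_in Y s -> a s = 0) /\
    (forall s, rho (~~ b) a s = c s).
Proof.
move=> FY tY [c0 rc]; have [idx [idx1 idx2 _]] :=
  @orbit_index p _ (push t) p_pr iter_push_p set0 (fun _ _ => @False_ind _).
exists (rho_lift (push t) idx (~~ b) c); split=> s.
  move=> sY; rewrite /rho_lift; case: ifP => _; first by rewrite c0 ?if_same.
  by rewrite big1 ?oppr0 // => l _; apply: c0; apply: lies_in_iter.
apply: (rho_liftK p_pr iter_push_p) => // {}s; last by rewrite negbK.
by move=> /push_fixedP/(lies_in_sub FY); apply: c0.
Qed.

(** Being dead depends on the class only: writing [e] as the image of [e'] under rho, replace [a] by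
    [a + dd e'], which has the same coboundary. *)
Lemma dead_dd m b c e : dead m b c -> special b fixedpts e ->
  dead m b (fun s => c s + dd e s).
Proof.
case: m => [|m] /=.
  move=> [e0 se0 ce0] se; exists (fun s => e0 s + e s) => [|s]; first exact: specialD.
  by rewrite ce0 dd_lin.
move=> [a [a0 ca da]] se.
have tF x : fixedpts x -> fixedpts (t x) by move=> e'; rewrite /fixedpts /= !e'.
have [e' [e'0 re']] := special_lift (@subset_refl _ _) tF se.
exists (fun s => a s + dd e' s); split.
- move=> s sF; rewrite a0 // add0r.
  by apply: (dd_eq0 (P := lies_in fixedpts)) sF => // k u i; exact: lies_in_face.
- move=> s; rewrite rhoD ca -dd_rho; congr (_ + dd _ s).
  by apply/funext => s'; rewrite re'.
- suff -> : dd (fun s => a s + dd e' s) = dd a by [].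
  by apply/funext => s; rewrite dd_lin dd_dd addr0.
Qed.

Lemma eq_dead m b c c' : (forall s, c s = c' s) -> dead m b c -> dead m b c'.
Proof. by move=> /funext ->. Qed.

Lemma rho_op (L : (Om -> Fp) -> Om -> Fp) b c s :
    (forall c c', L (fun s => c s - c' s) s = L c s - L c' s) ->
    (forall c l, L c (iter l (push t) s) = L (fun s => c (iter l (push t) s)) s) ->
  rho b (L c) s = L (rho b c) s.
Proof.
move=> LB Lt.
have L0 : L (fun=> 0) s = 0.
  have e := LB (fun=> 0) (fun=> 0); rewrite [RHS]subrr in e.
  by rewrite -[RHS]e; congr (L _ s); apply/funext => ?; rewrite subrr.
have LD c1 c2 : L (fun s => c1 s + c2 s) s = L c1 s + L c2 s.
  have := LB (fun s => c1 s + c2 s) c2.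
  rewrite (_ : (fun s => _ - _) = c1); first by move=> ->; rewrite subrK.
  by apply/funext => ?; rewrite addrK.
case: b; rewrite /rho /=; last by rewrite LB; congr (_ - _); apply: (Lt c 1%N).
have LS n : L (fun s => \sum_(0 <= i < n) c (iter i (push t) s)) s =
    \sum_(0 <= i < n) L c (iter i (push t) s).
  elim: n => [|n IH].
    by rewrite big_geq // -[RHS]L0; congr (L _ s); apply/funext => ?; rewrite big_geq.
  rewrite [RHS]big_nat_recr //= -IH Lt -LD; congr (L _ s).
  by apply/funext => ?; rewrite big_nat_recr.
rewrite -(big_mkord xpredT (fun i => L c (iter i (push t) s))) -LS; congr (L _ s).
by apply/funext => ?; rewrite big_mkord.
Qed.

(** Since [e] and [L c] are compared on the orbit of [s] only, [L] may vary with [s]. This admits a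
    number of subdivisions chosen for each orbit, and L = 0 on orbits outside [Y]. *)
Lemma rho_op_eq0 (L : (Om -> Fp) -> Om -> Fp) b c e s :
    (forall l, (l < p)%N -> e (iter l (push t) s) = L c (iter l (push t) s)) ->
    (forall c c', L (fun s => c s - c' s) s = L c s - L c' s) ->
    (forall c l, L c (iter l (push t) s) = L (fun s => c (iter l (push t) s)) s) ->
    (forall s, rho b c s = 0) -> rho b e s = 0.
Proof.
move=> eL LB Lt rc; transitivity (rho b (L c) s).
  rewrite /rho; case: (b); first by apply: eq_bigr => i _; apply: eL.
  by rewrite (eL 0%N) ?(eL 1%N) ?prime_gt0 ?prime_gt1.
rewrite rho_op //; have := LB (rho b c) (rho b c).
rewrite [RHS]subrr => e0; rewrite -[RHS]e0; congr (L _ s); apply/funext => s'.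
by rewrite subrr rc.
Qed.

Lemma iter_push_mulp s i : iter (i * p.-1) (push t) (iter i (push t) s) = s.
Proof.
rewrite -iterD -mulnSr prednK ?prime_gt0 //.
by rewrite -(iter_mod iter_push_p) modnMl.
Qed.

End Smith.

(* [B] is a subspace of [Y] containing the fixed points.  The homotopy [H] pushes
   the neighborhood [W0] of [B] into [B], and the translates of [W] are disjoint in
   [Y].  The first fact makes a cocycle vanish on [W0]; the second one, by choosing
   the preimage under [rho] with the help of the position in the orbit, makes its
   image under the connecting map vanish also on the translates of [W].  As [W0]
   and the translates of [W] cover [Y], that image is a coboundary on [Y]. *)
Section CellStep.
Variables (R : realType) (X : topologicalType) (p : nat).
Variable t : continuousType X X.
Hypotheses (p_pr : prime p) (tp : forall x, iter p t x = x).
Variables (B Y W W0 : set X) (H : X -> R -> X).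
Hypothesis H_cont : forall m (g : std_simplex R m -> X) (r : std_simplex R m -> R),
  continuous g -> continuous r -> (forall z, Y (g z)) ->
  (forall z, 0 <= r z <= 1) -> continuous (fun z => H (g z) (r z)).
Hypothesis H_push : forall y r, Y y -> H (t y) r = t (H y r).
Hypothesis H0 : forall y, Y y -> H y 0 = y.
Hypothesis H_base : forall y r, B y -> 0 <= r <= 1 -> B (H y r).
Hypothesis H1 : forall y, Y y -> W0 y -> B (H y 1).
Hypothesis fixB : fixedpts t `<=` B.
Hypothesis BY : B `<=` Y.
Hypothesis tB : forall x, B x -> B (t x).
Hypothesis tY : forall x, Y x -> Y (t x).
Hypothesis tW0 : forall x, W0 x -> W0 (t x).
Hypothesis W_open : open W.
Hypothesis W0_open : open W0.
Hypothesis W_disj : forall y i, Y y -> W y -> W (iter i t y) -> (i < p)%N -> i = 0%N.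
Hypothesis YW : forall y, Y y -> W0 y \/ exists2 i, (i < p)%N & W (iter i t y).

Local Notation Om := (simplex R X).
Local Notation Fp := 'F_p.
Implicit Types (c a e : Om -> Fp) (s : Om).
Local Notation rho := (rho (p := p) (push t)).
Local Notation special := (special (p := p) t).
Local Notation dead := (dead (p := p) t).

Lemma iter_cont i : continuous (iter i t).
Proof.
elim: i => [|i IH] x; first exact: cvg_id.
by have := cvg_comp _ _ (IH x); apply; exact: cts_fun.
Qed.

(** On [Y] the prism of [c] has coboundary H_1^* c - c, and H_1^* c is zero on [W0] because H_1 maps
    [W0] into [B]. *)
Lemma retract_step b c : special b B c -> dd c = (fun=> 0) ->
  exists2 e, special b B e &
    forall s, lies_in Y s -> lies_in W0 s -> c s + dd e s = 0.
Proof.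
(* The prism is cut off outside [Y], where the homotopy is not controlled. As [Y] is stable under t,
   this respects orbits. *)
move=> [c0 rc] dc; pose e s := if pselect (lies_in Y s) then prism H c s else 0.
have eE s : lies_in Y s -> e s = prism H c s.
  by rewrite /e; case: pselect.
exists e; first split.
- move=> s sB; rewrite eE; last exact: lies_in_sub sB.
  case: s sB => k u uB; apply: prism_eq0 => n w wH; apply: c0 => x.
  by have [y [r [r01 ->]]] := wH x; apply: H_base => //; apply: uB.
- move=> s; have [sY|nY] := pselect (lies_in Y s); last first.
    apply: (@rho_op_eq0 _ _ _ _ p_pr (fun _ _ => 0) b c e s) => // [l _|_ _].
      rewrite /e; case: pselect => // lY; case: nY.
      by rewrite -(iter_push_mulp p_pr tp s l); apply: lies_in_iter.
    by rewrite subrr.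
  apply: (@rho_op_eq0 _ _ _ _ p_pr (prism H) b c e s) => //.
  + by move=> l _; rewrite eE //; apply: lies_in_iter.
  + by move=> *; apply: prismB.
  + move=> c1 l; elim: l c1 => // l IH c1; rewrite iterS.
    have := lies_in_iter l tY sY; case E : (iter l (push t) s) => [k u] uY.
    by rewrite (prism_push H_cont) // -[mk_simplex u]E IH.
- move=> [k u] uY uW0.
  have -> : dd e (mk_simplex u) = dd (prism H c) (mk_simplex u).
    case: k u uY {uW0} => //= k u uY; apply: eq_bigr => i _; rewrite eE //.
    exact: lies_in_face.
  rewrite (prism_homotopy H_cont) // [X in _ - X](@cvalE _ _ _ _ _ u); last first.
    by move=> x; rewrite H0 //; apply: uY.
  rewrite addrCA subrr addr0 /cval; case: pselect => // cw; apply: c0 => x.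
  by apply: H1; [apply: uY|apply: uW0].
Qed.

(** Representatives are taken in [W] when possible. All simplices of [Y] inside one translate of [W]
    then have the same index, so the lift commutes with the coboundary there and [dd c = 0] gives
    [dd a = 0]. *)
Lemma lift_step b c : special b B c -> dd c = (fun=> 0) ->
    (forall s, lies_in Y s -> lies_in W0 s -> c s = 0) ->
  exists a, [/\ forall s, lies_in B s -> a s = 0,
    forall s, rho (~~ b) a s = c s,
    forall s, lies_in Y s -> lies_in W0 s -> a s = 0 &
    forall i s, lies_in Y s -> lies_in [set x | W (iter i t x)] s -> dd a s = 0].
Proof.
move=> [c0 rc] dc cW0; pose Q s := lies_in (Y `&` W) s.
have Q1 s i : Q s -> Q (iter i (push t) s) -> (i < p)%N -> i = 0%N.
  case: s => k u uQ; have [v -> vE] := iter_push t i u; move=> vQ.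
  have x : std_simplex R k.
    by exists (delta_mx 0 ord0); apply: mem_set; apply: delta_simplex.
  by have [uY uW] := uQ x; have [_] := vQ x; rewrite vE; apply: W_disj.
have [idx [idx1 idx2 idx3]] := orbit_index p_pr (iter_push_p tp) Q1.
exists (rho_lift (push t) idx (~~ b) c); split.
- move=> s sB; rewrite /rho_lift; case: ifP => _; first by rewrite c0 ?if_same.
  by rewrite big1 ?oppr0 // => l _; apply: c0; apply: lies_in_iter.
- move=> s; apply: (rho_liftK p_pr (iter_push_p tp)) => // {}s; last by rewrite negbK.
  by move=> /push_fixedP/(lies_in_sub fixB); apply: c0.
- move=> s sY sW; rewrite /rho_lift; case: ifP => _; first by rewrite cW0 ?if_same.
  by rewrite big1 ?oppr0 // => l _; apply: cW0; apply: lies_in_iter.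
- move=> i s sY sW.
  (* The representative is t^i s', so the index is -i modulo p, written as i(p-1). *)
  have idxE s' : lies_in Y s' -> lies_in [set x | W (iter i t x)] s' ->
      idx s' = ((i * p.-1) %% p)%N.
    move=> s'Y s'W; rewrite -{1}(iter_push_mulp p_pr tp s' i).
    rewrite -(iter_mod (iter_push_p tp)); apply: idx3; last first.
      by rewrite ltn_mod prime_gt0.
    case: s' s'Y s'W => k u uY uW; have [v ev vE] := iter_push t i u.
    rewrite [iter _ _ _]ev => x; split; last by rewrite vE; apply: uW.
    by rewrite vE; elim: (i) => [|j IHj]; [apply: uY | apply: tY].
  case: s sY sW => -[|k] u uY uW //.
  rewrite dd_rho_lift => [|j].
    rewrite dc /rho_lift; case: ifP => _; first by rewrite if_same.
    by rewrite big1 ?oppr0.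
  by rewrite !idxE //; apply: lies_in_face.
Qed.

(** The cocycle [dd a] vanishes on every simplex of [Y] inside one member of the cover, so
    [small_simplices] integrates it. The primitive is again special because subdivision stays inside
    the image of a simplex and commutes with t. *)
Lemma subdivide_step b a : special b B (dd a) ->
    (forall s, lies_in Y s -> lies_in W0 s -> a s = 0) ->
    (forall i s, lies_in Y s -> lies_in [set x | W (iter i t x)] s -> dd a s = 0) ->
  exists2 e, special b B e & forall s, lies_in Y s -> dd e s = dd a s.
Proof.
move=> [a0 ra] aW0 aW.
have face_in k (s : singular_simplex R X k.+1) (i : 'I_k.+2) :
    lies_in Y (mk_simplex s) -> lies_in Y (mk_simplex (s \o face R i)).
  exact: lies_in_face.
have small k (s : singular_simplex R X k) : lies_in Y (mk_simplex s) ->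
    exists2 e, 0 < e &
      forall k', small_eq0 (std_simplex R k) k' e (ev (dd a) (extend s)).
  move=> sY.
  apply: (small_cover (U := [set V | V = W0 \/ exists i, V = [set x | W (iter i t x)]])).
  - move=> V [->|[i ->]] //.
    by have /continuousP := @iter_cont i; apply.
  - move=> x; have [|[i ip]] := YW (sY x); first by exists W0 => //; left.
    by exists [set x | W (iter i t x)] => //; right; exists i.
  - move=> V n w [->|[i ->]] wV ws.
      have wY : lies_in Y (mk_simplex w) by move=> x; have [y ->] := ws x; apply: sY.
      apply: (dd_eq0 (P := fun s => lies_in Y s /\ lies_in W0 s)) => //.
        by move=> k' u i [uY uW]; split; apply: lies_in_face.
      by move=> s' [? ?]; apply: aW0.
    by apply: (aW i) => // x; have [y ->] := ws x; apply: sY.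
have [e [de eN eY]] := small_simplices face_in (dd_dd a) small.
exists e => //; split=> s.
  move=> sB; have sY := lies_in_sub BY sB; have [m0 /(_ _ (leqnn _)) ->] := eY s sY.
  case: s sB {sY} => k u uB; apply: subdivide_eq0 => n w wu; apply: a0 => x.
  by have [y ->] := wu x; apply: uB.
have [sY|nY] := pselect (lies_in Y s); last first.
  apply: (@rho_op_eq0 _ _ _ _ p_pr (fun _ _ => 0) b (dd a) e s) => // [l _|_ _].
    apply: eN => lY; apply: nY.
    by rewrite -(iter_push_mulp p_pr tp s l); apply: lies_in_iter.
  by rewrite subrr.
have /choice[m mP] : forall l, exists m0, forall m, (m0 <= m)%N ->
    e (iter l (push t) s) = subdivide m (dd a) (iter l (push t) s).
  by move=> l; apply: eY; apply: lies_in_iter.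
(* One number of subdivisions that works for all [p] translates of [s]. *)
apply: (@rho_op_eq0 _ _ _ _ p_pr (subdivide (\max_(l < p) m l)) b (dd a)) => //.
- move=> l lp; apply: mP.
  exact: (leq_bigmax (F := fun l : 'I_p => m l) (Ordinal lp)).
- by move=> *; apply: subdivideB.
- by move=> c1 l; elim: l c1 => // l IH c1; rewrite iterS subdivide_push IH.
Qed.

(** Up to coboundaries of special cochains, [c] is the image of [a] under rho and [dd a] vanishes on
    [Y], where the hypothesis applies. Passing from [c] to [dd a] is the one connecting map that is
    spent. *)
Lemma cell_step m :
    (forall b c, special b Y c -> dd c = (fun=> 0) -> dead m b c) ->
  forall b c, special b B c -> dd c = (fun=> 0) -> dead m.+1 b c.
Proof.
move=> IH b c sc dc.
have [e se ce] := retract_step sc dc.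
have sc' : special b B (fun s => c s + dd e s) by apply: specialD => //; exact: special_dd.
have dc' : dd (fun s => c s + dd e s) = (fun=> 0).
  by apply/funext => s; rewrite dd_lin dc dd_dd addr0.
have [a [a0 ra aW0 aW]] := lift_step sc' dc' ce.
have sa : special (~~ b) B (dd a).
  split=> s.
    by move=> sB; apply: (dd_eq0 (P := lies_in B)) => // k u i; exact: lies_in_face.
  rewrite -dd_rho (_ : rho (~~ b) a = (fun s => c s + dd e s)) ?dc' //.
  by apply/funext.
have [e2 se2 e2E] := subdivide_step sa aW0 aW.
have se2' := specialN se2.
have dead_a : dead m (~~ b) (dd a).
  have : dead m (~~ b) (fun s => (dd a s + dd (fun s => - e2 s) s) + dd e2 s).
    apply: (dead_dd p_pr tp (c := fun s => dd a s + dd (fun s => - e2 s) s));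
      last exact: special_sub se2.
    apply: IH.
      split=> s; last by have [_ ->] := specialD sa (special_dd se2').
      by move=> sY; rewrite ddN e2E // subrr.
    by apply/funext => s; rewrite dd_lin !dd_dd addr0.
  by apply: eq_dead => s; rewrite ddN subrK.
have dc1 : dead m.+1 b (fun s => c s + dd e s).
  exists a; split => // s; first by move=> /(lies_in_sub fixB); apply: a0.
have : dead m.+1 b (fun s => (c s + dd e s) + dd (fun s => - e s) s).
  by apply: dead_dd => //; apply: special_sub (specialN se).
by apply: eq_dead => s; rewrite ddN addrK.
Qed.

End CellStep.

(** * Attaching a free cell *)

Section Topology.

Lemma cont_comp (X Y Z : topologicalType) (f : X -> Y) (g : Y -> Z) :
  continuous f -> continuous g -> continuous (fun x => g (f x)).
Proof. by move=> cf cg x; exact: (continuous_comp (cf x) (cg _)). Qed.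

Lemma cont_pair (X Y Z : topologicalType) (f : X -> Y) (g : X -> Z) :
  continuous f -> continuous g -> continuous (fun x => (f x, g x)).
Proof. by move=> cf cg x; apply: cvg_pair; [exact: cf | exact: cg]. Qed.

Lemma cont_fst (X Y : topologicalType) : continuous (@fst X Y).
Proof. by move=> x; exact: cvg_fst. Qed.

Lemma cont_snd (X Y : topologicalType) : continuous (@snd X Y).
Proof. by move=> x; exact: cvg_snd. Qed.

Lemma closed_pullback (X Y : topologicalType) (f : X -> Y) (C : set Y) :
  continuous f -> closed C -> closed [set x | C (f x)].
Proof. by move=> /continuous_closedP; apply. Qed.

Lemma open_pullback (X Y : topologicalType) (f : X -> Y) (C : set Y) :
  continuous f -> open C -> open [set x | C (f x)].
Proof. by move=> /continuousP; apply. Qed.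

Lemma hausdorff_pair (X Y : topologicalType) : hausdorff_space X ->
  hausdorff_space Y -> hausdorff_space (X * Y)%type.
Proof.
rewrite !open_hausdorff => hX hY [x1 y1] [x2 y2]; rewrite xpair_eqE negb_and.
case/orP => [/hX|/hY] [[U V] /= [/set_mem xU /set_mem yV] [oU oV /eqP UV]].
  exists (fst @^-1` U, fst @^-1` V); split; rewrite /= ?inE //.
  - exact: (open_pullback (@cont_fst X Y)).
  - exact: (open_pullback (@cont_fst X Y)).
  - by rewrite -preimage_setI UV preimage_set0.
exists (snd @^-1` U, snd @^-1` V); split; rewrite /= ?inE //.
- exact: (open_pullback (@cont_snd X Y)).
- exact: (open_pullback (@cont_snd X Y)).
- by rewrite -preimage_setI UV preimage_set0.
Qed.

Lemma closed_fixed (X : topologicalType) (f : X -> X) : hausdorff_space X ->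
  continuous f -> closed [set x | f x = x].
Proof.
rewrite open_hausdorff => hX cf; rewrite -[X in closed X]setCK; apply: open_closedC.
rewrite openE => x /= /eqP /hX [[U V] /= [/set_mem xU /set_mem yV] [oU oV /eqP UV]].
have : nbhs x (V `&` f @^-1` U).
  apply: filterI; first by apply: open_nbhs_nbhs.
  by apply: cf; apply: open_nbhs_nbhs.
apply: filterS => z [Vz Uz] /= e; rewrite /= e in Uz.
by have : (U `&` V) z by []; rewrite UV.
Qed.

End Topology.

Section Disc.
Variables (R : realType) (n : nat).
Implicit Types x : 'rV[R]_n.

Definition enorm x : R := Num.sqrt (\sum_j x ord0 j ^+ 2).

Let sumsq_ge0 x : 0 <= \sum_j x ord0 j ^+ 2.
Proof. by apply: sumr_ge0 => j _; apply: sqr_ge0. Qed.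

Lemma enorm_discE x : disc R n x = (enorm x <= 1).
Proof. by rewrite /enorm -[X in _ <= X]sqrtr1 ler_sqrt ?ltr01. Qed.

Lemma enorm_open_discE x : open_disc R n x = (enorm x < 1).
Proof. by rewrite /enorm -[X in _ < X]sqrtr1 ltr_sqrt ?ltr01. Qed.

Lemma enorm_sphere x : enorm x = 1 -> sphere R n x.
Proof. by move=> e; rewrite /sphere /= -[LHS]sqr_sqrtr // -/(enorm x) e expr1n. Qed.

Lemma enormZ a x : 0 <= a -> enorm (a *: x) = a * enorm x.
Proof.
move=> a0; rewrite /enorm -{2}(ger0_norm a0) -sqrtr_sqr -sqrtrM ?sqr_ge0 //.
by rewrite mulr_sumr; congr Num.sqrt; apply: eq_bigr => j _; rewrite mxE exprMn.
Qed.

Lemma enorm_continuous : continuous enorm.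
Proof.
have cq : continuous (fun x : 'rV[R]_n => \sum_j x ord0 j ^+ 2).
  apply: continuous_sumr => j x; have cj := @coord_continuous R 1 n ord0 j x.
  exact: (cvgM cj cj).
by move=> x; exact: (continuous_comp (cq x) (@sqrt_continuous R _)).
Qed.

Definition retr x : 'rV[R]_n := (Num.max 1 (enorm x))^-1 *: x.

Lemma retr_disc x : enorm (retr x) <= 1.
Proof.
rewrite /retr enormZ ?invr_ge0 ?le_max ?ler01 // mulrC ler_pdivrMr.
  by rewrite mul1r le_max lexx orbT.
by rewrite lt_max ltr01.
Qed.

Lemma retr_id x : enorm x <= 1 -> retr x = x.
Proof. by move=> x1; rewrite /retr max_l // invr1 scale1r. Qed.

Lemma retr_sphere x : 1 <= enorm x -> enorm (retr x) = 1.
Proof.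
move=> x1; rewrite /retr enormZ ?invr_ge0 ?le_max ?ler01 // max_r // mulVf //.
by rewrite gt_eqF // (lt_le_trans ltr01).
Qed.

Lemma retr_scale_sphere a x : enorm x = 1 -> 1 <= a -> retr (a *: x) = x.
Proof.
move=> x1 a1; have a0 : 0 < a by apply: lt_le_trans a1.
by rewrite /retr enormZ ?ltW // x1 mulr1 max_r // scalerK ?gt_eqF.
Qed.

Lemma retr_continuous : continuous retr.
Proof.
move=> x.
have cm : continuous (fun x : 'rV[R]_n => Num.max (1 : R) (enorm x)).
  apply: (@max_fun_continuous _ _ R (fun=> 1) (@enorm)) .
    by move=> z; apply: cst_continuous.
  exact: enorm_continuous.
have m0 : Num.max 1 (enorm x) != 0 by rewrite gt_eqF // lt_max ltr01.
have ci := continuous_comp (cm x) (inv_continuous m0).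
exact: (cvgZ ci cvg_id).
Qed.

Lemma compact_ball r : compact [set x | enorm x <= r].
Proof.
apply: bounded_closed_compact; last first.
  have /continuous_closedP ec := enorm_continuous.
  exact: (ec _ (@closed_le R r)).
exists `|r|; split=> // M rM x /= xr; apply: le_trans (ltW rM).
apply: row_norm_le => // j; apply: le_trans (le_trans xr (ler_norm r)).
rewrite -sqrtr_sqr ler_sqrt // (bigD1 j) //= lerDl.
by apply: sumr_ge0 => i _; apply: sqr_ge0.
Qed.

End Disc.

Section FreeCell.
Variables (R : realType) (p : nat) (G : finGroupType) (X : topologicalType).
Variables (h : left_action G X) (g0 : G).
Hypotheses (p_pr : prime p) (hX : hausdorff_space X).
Hypothesis g0_gen : forall g : G, exists2 i, (i < p)%N & g = (g0 ^+ i)%g.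
Hypothesis g0_ord : forall i, (i < p)%N -> (g0 ^+ i)%g = 1%g -> i = 0%N.
Hypothesis g0_p : (g0 ^+ p)%g = 1%g.

Definition gen_act : continuousType X X := mkcts (@act_continuous G X h g0).

Lemma iter_gen_act i x : iter i gen_act x = h (g0 ^+ i)%g x.
Proof.
elim: i => [|i IH]; first by rewrite expg0 act_one.
by rewrite iterS IH expgS act_mul.
Qed.

Lemma gen_act_p x : iter p gen_act x = x.
Proof. by rewrite iter_gen_act g0_p act_one. Qed.

Lemma act_inv g x : h g^-1%g (h g x) = x.
Proof. by rewrite -act_mul mulVg act_one. Qed.

Variables (n : nat) (phi : 'rV[R]_n -> X) (B : set X).
Hypothesis phi_cont : continuous phi.
Hypothesis phi_retr : forall x, phi (retr x) = phi x.
Hypothesis B_closed : closed B.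
Hypothesis B_act : forall g x, B x -> B (h g x).
Hypothesis phi_sphere : forall x, enorm x = 1 -> B (phi x).
Hypothesis phi_open : forall g x, enorm x < 1 -> ~ B (h g (phi x)).
Hypothesis phi_inj : forall g g' x x', enorm x < 1 -> enorm x' < 1 ->
  h g (phi x) = h g' (phi x') -> g = g' /\ x = x'.
Hypothesis fixB : fixedpts gen_act `<=` B.

Definition in_cell (y : X) : Prop := exists g x, enorm x < 1 /\ y = h g (phi x).

Definition add_cell : set X := [set y | B y \/ in_cell y].

(* Radial expansion of the cell.  As [phi] factors through the retraction of the
   Euclidean space onto the disc, points stop when they reach the boundary; at time 1
   those at distance at least 1/2 from the center have reached it. *)
Definition cell_homotopy (y : X) (r : R) : X :=
  if pselect (in_cell y) is left yC then
    let g := projT1 (cid yC) in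
    h g (phi ((1 + r) *: projT1 (cid (projT2 (cid yC)))))
  else y.

Lemma cell_homotopy_out y r : B y -> cell_homotopy y r = y.
Proof.
move=> By; rewrite /cell_homotopy; case: pselect => // yC; exfalso.
by case: yC => g [x [x1 e]]; apply: (phi_open (g := g) x1); rewrite -e.
Qed.

Lemma cell_homotopy_in g x r : enorm x < 1 ->
  cell_homotopy (h g (phi x)) r = h g (phi ((1 + r) *: x)).
Proof.
move=> x1; rewrite /cell_homotopy; case: pselect => [yC|[]]; last by exists g, x.
case: cid => g' /= yC'; case: cid => x' /= [x'1 e].
by have [-> ->] := phi_inj x1 x'1 e.
Qed.

Lemma cell_homotopy_disc g x r : enorm x <= 1 -> 0 <= r ->
  cell_homotopy (h g (phi x)) r = h g (phi ((1 + r) *: x)).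
Proof.
rewrite le_eqVlt => /orP[/eqP x1|x1] r0; last exact: cell_homotopy_in.
rewrite cell_homotopy_out; last by apply: B_act; apply: phi_sphere.
by rewrite -[in RHS]phi_retr retr_scale_sphere // lerDl.
Qed.

Lemma cell_homotopy_act g y r : add_cell y ->
  cell_homotopy (h g y) r = h g (cell_homotopy y r).
Proof.
case=> [By|[g' [x [x1 ->]]]]; first by rewrite !cell_homotopy_out //; apply: B_act.
by rewrite -act_mul !cell_homotopy_in // act_mul.
Qed.

(** The preimage of a closed [C] is a finite union of closed sets: one from [B], where the homotopy
    is stationary, and one for each translate of the cell. The latter is pulled back from [Q k], a
    compact, hence closed, subset of the Hausdorff space X x R. *)
Lemma cell_homotopy_cont m (g : std_simplex R m -> X) (r : std_simplex R m -> R) :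
  continuous g -> continuous r -> (forall z, add_cell (g z)) ->
  (forall z, 0 <= r z <= 1) -> continuous (fun z => cell_homotopy (g z) (r z)).
Proof.
move=> cg cr gY r01; apply/continuous_closedP => C closedC.
pose disc_cyl := [set x : 'rV[R]_n | enorm x <= 1] `*` [set r : R | 0 <= r <= 1].
have disc_cyl_compact : compact disc_cyl.
  apply: compact_setX; first exact: compact_ball.
  have -> : [set r : R | 0 <= r <= 1] = `[0, 1]%classic.
    by apply/seteqP; split=> z /=; rewrite in_itv.
  exact: segment_compact.
have act_phi_cont k : continuous (fun x => h k (phi x)).
  by apply: cont_comp => //; apply: act_continuous.
pose Q k := (fun z : 'rV[R]_n * R => (h k (phi z.1), z.2)) @`
  (disc_cyl `&` [set z | C (h k (phi ((1 + z.2) *: z.1)))]).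
have Q_closed k : closed (Q k).
  apply: compact_closed.
    by apply: hausdorff_pair => //; apply: Rhausdorff.
  apply: continuous_compact.
    apply: continuous_subspaceT; apply: cont_pair; last exact: cont_snd.
    exact: (cont_comp (@cont_fst _ _) (act_phi_cont k)).
  apply: (subclosed_compact _ disc_cyl_compact); last by move=> ? [].
  apply: closedI; first by apply: compact_closed.
  have scale_cont : continuous (fun z : 'rV[R]_n * R => (1 + z.2) *: z.1).
    move=> z; apply: (cvgZ _ cvg_fst).
    by apply: (cvgD (cvg_cst _) cvg_snd).
  exact: (closed_pullback (cont_comp scale_cont (act_phi_cont k))).
have -> : (fun z => cell_homotopy (g z) (r z)) @^-1` C =
    (g @^-1` (B `&` C)) `|`
    \bigcup_(k in [set: G]) ((fun z => (g z, r z)) @^-1` Q k).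
  apply/seteqP; split=> z /=.
    have [Bg|[k [x [x1 e]]]] := gY z.
      by rewrite cell_homotopy_out //; left.
    rewrite e cell_homotopy_in // => Cz; right; exists k => //.
    exists (x, r z) => //; last by rewrite e.
    by split=> [|//]; split; [exact: ltW | exact: r01].
  move=> [[Bg Cg]|[k _ [[x s] [[/= x1 s01] Cx] [e1 e2]]]].
    by rewrite cell_homotopy_out.
  by rewrite -e1 -e2 cell_homotopy_disc //; have /andP[] := s01.
apply: closedU.
  by apply: closed_pullback => //; apply: closedI.
apply: closed_bigcup => [|k _]; first exact: finite_finset.
by apply: closed_pullback => //; apply: cont_pair.
Qed.

Lemma cell_image_closed k r : closed [set y | exists2 x, enorm x <= r & y = h k (phi x)].
Proof.
have -> : [set y | exists2 x, enorm x <= r & y = h k (phi x)] =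
    (fun x => h k (phi x)) @` [set x | enorm x <= r].
  by apply/seteqP; split=> y [x x1 e]; exists x.
apply: compact_closed => //; apply: continuous_compact; last exact: compact_ball.
by apply: continuous_subspaceT; apply: cont_comp => //; apply: act_continuous.
Qed.

Lemma free_cell_step m :
    (forall b c, special (R := R) (p := p) gen_act b add_cell c ->
       dd c = (fun=> 0) -> dead (p := p) gen_act m b c) ->
  forall b c, special (R := R) (p := p) gen_act b B c -> dd c = (fun=> 0) ->
    dead (p := p) gen_act m.+1 b c.
Proof.
pose img k r := [set y | exists2 x : 'rV[R]_n, enorm x <= r & y = h k (phi x)].
(* Inside [add_cell] this is the open cell phi(open disc) without its other translates. As the
   complement of finitely many closed sets it is open in all of [X], which the cover by [W0] and
   translates of [W] requires. *)
pose W := ~` (B `|` \bigcup_(i in [set i : 'I_p | (0 < i)%N]) img (g0 ^+ i)%g 1).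
pose W0 := ~` \bigcup_(k in [set: G]) img k (2%:R^-1).
have half1 (x : 'rV[R]_n) : enorm x <= 2%:R^-1 -> enorm x < 1.
  by move=> xh; apply: le_lt_trans xh _; rewrite invf_lt1 ?ltr1n.
have phi_W x : enorm x < 1 -> W (phi x).
  move=> x1 [|[i /= i0 [x']]].
    by rewrite -[phi x](act_one h); apply: phi_open.
  rewrite le_eqVlt => /orP[/eqP x'1|x'1] e.
    by apply: (@phi_open 1%g x x1); rewrite act_one e; apply: B_act; apply: phi_sphere.
  have := @phi_inj 1%g (g0 ^+ i)%g x x' x1 x'1; rewrite act_one e => -[] // /esym.
  by move=> /(g0_ord (ltn_ord i)) ii; rewrite ii in i0.
have W_phi g x : enorm x < 1 -> W (h g (phi x)) -> g = 1%g.
  move=> x1 Wx; have [[|i] ip ge] := g0_gen g; first by rewrite ge expg0.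
  case: Wx; right; exists (Ordinal ip) => //; exists x; first exact: ltW.
  by rewrite ge.
apply: (cell_step p_pr gen_act_p (W := W) (W0 := W0) (H := cell_homotopy)).
- exact: cell_homotopy_cont.
- by move=> y r yY; apply: cell_homotopy_act.
- move=> y [By|[g [x [x1 ->]]]]; first exact: cell_homotopy_out.
  by rewrite cell_homotopy_in // addr0 scale1r.
- by move=> y r By _; rewrite cell_homotopy_out.
- move=> y [By|[g [x [x1 ->]]]] W0y; first by rewrite cell_homotopy_out.
  rewrite cell_homotopy_in //; apply: B_act; rewrite -phi_retr; apply: phi_sphere.
  apply: retr_sphere; rewrite enormZ //.
  have xh : 2%:R^-1 < enorm x.
    by rewrite ltNge; apply/negP => xh; apply: W0y; exists g => //; exists x.
  by rewrite -ler_pdivrMl ?mulr1 ?ltW.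
- exact: fixB.
- by left.
- by move=> x; apply: B_act.
- move=> x [Bx|[g [y [y1 ->]]]]; first by left; apply: B_act.
  by right; exists (g0 * g)%g, y; rewrite act_mul.
- move=> x W0x [k _ [y y1 e]]; apply: W0x; exists (g0^-1 * k)%g => //; exists y => //.
  by rewrite act_mul -e act_inv.
- apply: closed_openC; apply: closedU => //; apply: closed_bigcup => [|i _].
    exact: finite_finset.
  exact: cell_image_closed.
- apply: closed_openC; apply: closed_bigcup => [|i _]; first exact: finite_finset.
  exact: cell_image_closed.
- move=> y i [By|[g [x [x1 ->]]]] Wy; first by case: Wy; left.
  have g1 := W_phi g x x1 Wy; rewrite iter_gen_act g1 act_one => Wi ip.
  exact: (g0_ord ip (W_phi _ x x1 Wi)).
- move=> y [By|[g [x [x1 ->]]]].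
    left=> -[k _ [x xh e]]; apply: (@phi_open k x (half1 _ xh)); by rewrite -e.
  right; have [i ip gi] := g0_gen g^-1%g; exists i => //.
  by rewrite iter_gen_act -gi act_inv; apply: phi_W.
Qed.

End FreeCell.

Lemma continuous_within_comp (X Y Z : topologicalType) (K : set Y) (f : X -> Y)
    (g : Y -> Z) : continuous f -> (forall x, K (f x)) ->
  {within K, continuous g} -> continuous (fun x => g (f x)).
Proof.
move=> cf fK /continuousP cg; apply/continuousP => A oA.
have /open_subspaceP[V oV VK] := cg A oA.
have -> : (fun x => g (f x)) @^-1` A = f @^-1` V.
  apply/seteqP; split=> x /= xA.
    by have : (g @^-1` A `&` K) (f x) by []; rewrite -VK => -[].
  by have : (V `&` K) (f x) by []; rewrite VK => -[].
exact: open_pullback.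
Qed.

(** * Nilpotency for a finite G-CW complex *)

Section Nilpotency.
Variables (R : realType) (p : nat) (G : finGroupType) (X : topologicalType).
Variables (h : left_action G X) (g0 : G) (K : finite_GCW R h).
Hypotheses (p_pr : prime p) (Gp : #|G| = p) (hX : hausdorff_space X).
Hypothesis g0_gen : forall g : G, exists2 i, (i < p)%N & g = (g0 ^+ i)%g.
Hypothesis g0_ord : forall i, (i < p)%N -> (g0 ^+ i)%g = 1%g -> i = 0%N.
Hypothesis g0_p : (g0 ^+ p)%g = 1%g.

Local Notation t := (gen_act h g0).
Local Notation fullG := [set: G]%SET.

Lemma fixedptsP x : fixedpts t x -> forall g, h g x = x.
Proof.
move=> fx g; have [i _ ->] := g0_gen g; rewrite -iter_gen_act.
by elim: i => //= i ->.
Qed.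

Lemma stab_cases (e : gcw_cell K) : gcw_stab e = 1%g :> {set G} \/ gcw_stab e = fullG :> {set G}.
Proof.
have pG : prime #|fullG| by rewrite cardsT Gp.
have [sT|] := boolP (fullG \subset gcw_stab e).
  by right; apply/eqP; rewrite finset.eqEsubset finset.subsetT.
by move=> /(prime_TIg pG) TI; left; rewrite -[LHS]finset.setTI TI.
Qed.

(** All fixed points are included from the start. They contain the cells with full stabilizer, so
    only the free cells of [S] add anything. *)
Definition subcomplex (S : {set gcw_cell K}) : set X :=
  [set y | fixedpts t y \/
    exists e, [/\ e \in S, gcw_stab e = 1%g :> {set G} &
                  open_cell h (gcw_char e) y]].

Lemma nonfree_fixed (e : gcw_cell K) y : gcw_stab e = fullG :> {set G} ->
  open_cell h (gcw_char e) y -> fixedpts t y.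
Proof.
move=> eT [g _ [x x1 <-]]; change (h g0 (h g (gcw_char e x)) = h g (gcw_char e x)); rewrite -act_mul.
have -> : (g0 * g = g * (g^-1 * g0 * g))%g by rewrite !mulgA mulgV mul1g.
rewrite act_mul gcw_char_stab ?eT ?finset.in_setT //.
by rewrite enorm_discE ltW // -enorm_open_discE.
Qed.

(** A characteristic map is continuous on the disc only; the radial retraction makes it continuous
    on the whole Euclidean space. *)
Definition char_ext (e : gcw_cell K) (x : 'rV[R]_(gcw_dim e)) : X := gcw_char e (retr x).

Lemma char_ext_cont e : continuous (@char_ext e).
Proof.
apply: (continuous_within_comp (K := disc R _)).
- exact: retr_continuous.
- by move=> x; rewrite enorm_discE retr_disc.
- exact: gcw_char_continuous.
Qed.

Lemma char_extE e x : enorm x <= 1 -> @char_ext e x = gcw_char e x.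
Proof. by move=> x1; rewrite /char_ext retr_id. Qed.

(** Expressed by dimension, since [gcw_attach] locates the boundary of a cell merely in cells of
    smaller dimension. *)
Definition down_closed (S : {set gcw_cell K}) := forall e e', e \in S ->
  (gcw_dim e' < gcw_dim e)%N -> e' \in S.

Lemma boundary_subcomplex (S : {set gcw_cell K}) e x :
  (forall e', (gcw_dim e' < gcw_dim e)%N -> e' \in S) ->
  enorm x = 1 -> subcomplex S (@char_ext e x).
Proof.
move=> eS x1; rewrite char_extE ?x1 //.
have [e' e'e cy] := gcw_attach _ _ _ _ K e x (enorm_sphere x1).
have [e'1|e'T] := stab_cases e'; last by left; apply: nonfree_fixed cy.
by right; exists e'; split => //; apply: eS.
Qed.

Lemma subcomplex_act (S : {set gcw_cell K}) g y :
  subcomplex S y -> subcomplex S (h g y).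
Proof.
case=> [fy|[e [eS e1 [k _ [x x1 <-]]]]].
  by left; rewrite (fixedptsP fy).
by right; exists e; split => //; exists (g * k)%g => //; exists x => //; rewrite act_mul.
Qed.

(** The boundaries of the cells of [S] already lie in the subcomplex, so the open cells may be
    replaced by the closed ones: finitely many compact images. *)
Lemma subcomplex_closed (S : {set gcw_cell K}) : down_closed S ->
  closed (subcomplex S).
Proof.
move=> dS.
have -> : subcomplex S = fixedpts t `|`
    \bigcup_(e in [set e | e \in S /\ gcw_stab e = 1%g :> {set G}])
      \bigcup_(g in [set: G]) [set y | exists2 x, enorm x <= 1 & y = h g (@char_ext e x)].
  apply/seteqP; split=> y.
    case=> [fy|[e [eS e1 [k _ [x x1 <-]]]]]; first by left.
    have {}x1 : enorm x <= 1 by rewrite ltW // -enorm_open_discE.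
    by right; exists e => //; exists k => //; exists x => //; rewrite char_extE.
  case=> [fy|[e [eS e1] [k _ [x + ->]]]]; first by left.
  rewrite le_eqVlt => /orP[/eqP x1|x1].
    by apply: subcomplex_act; apply: boundary_subcomplex => // e'; apply: dS.
  right; exists e; split => //; exists k => //; exists x; rewrite ?char_extE ?ltW //.
  by rewrite enorm_open_discE.
apply: closedU; first by apply: closed_fixed => //; apply: act_continuous.
apply: closed_bigcup => [|e _]; first exact: finite_finset.
apply: closed_bigcup => [|g _]; first exact: finite_finset.
by apply: cell_image_closed => //; apply: char_ext_cont.
Qed.

(** Induction on the number of cells outside [S], from the whole complex down to the fixed points
    alone. *)
Lemma gcw_nilpotent : exists m, forall b c,
  special (R := R) (p := p) t b (fixedpts t) c -> dd c = (fun=> 0) ->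
  dead (p := p) t m b c.
Proof.
suff IH n (S : {set gcw_cell K}) : #|~: S| = n -> down_closed S ->
    exists m, forall b c, special (R := R) (p := p) t b (subcomplex S) c ->
      dd c = (fun=> 0) -> dead (p := p) t m b c.
  have [|m mP] := IH _ finset.set0 erefl; first by move=> e e'; rewrite finset.in_set0.
  exists m => b c sc; apply: mP; apply: special_sub sc.
  by move=> y [//|[e [+ _ _]]]; rewrite finset.in_set0.
elim: n S => [|n IH] S Sn dS.
  (* With all cells in [S] the subcomplex is [X], so [c] vanishes identically. *)
  exists 0%N => b c [c0 _] _; exists (fun=> 0).
    split=> // s; rewrite /rho; case: (b); first exact: big1.
    by rewrite subrr.
  move=> s; rewrite dd0 c0 //; case: s => k u x.
  have [e ye] := gcw_cover _ _ _ _ K (u x).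
  have eS : e \in S.
    by apply/negPn; rewrite -finset.in_setC; move/eqP: Sn; rewrite cards_eq0 => /eqP ->; rewrite finset.in_set0.
  have [e1|eT] := stab_cases e; last by left; apply: nonfree_fixed ye.
  by right; exists e.
have [e0 e0S] : exists e0, e0 \in ~: S.
  by apply/finset.set0Pn; rewrite -card_gt0 Sn.
(* Minimal dimension among the missing cells keeps [S'] down-closed and puts the boundary of [e]
   into the subcomplex of [S]. *)
have [e eS emin] := arg_minnP (@gcw_dim _ _ _ _ K) e0S.
have eNS : e \notin S by rewrite -finset.in_setC.
have ltS e' : (gcw_dim e' < gcw_dim e)%N -> e' \in S.
  move=> lt; apply/negPn; rewrite -finset.in_setC; apply/negP => /emin.
  by rewrite leqNgt lt.
pose S' := e |: S.
have dS' : down_closed S'.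
  move=> e1 e2; rewrite !finset.in_setU1 => /orP[/eqP -> /ltS ->|e1S lt]; first by rewrite orbT.
  by rewrite (dS e1) ?orbT.
have [|m mP] := IH S' _ dS'.
  have := finset.cardsC S; have := finset.cardsC S'.
  by rewrite cardsU1 eNS Sn; lia.
(* A cell with full stabilizer consists of fixed points, so the subcomplex does not change and [m]
   is kept. *)
have [e1|eT] := stab_cases e; last first.
  exists m => b c sc; apply: mP; apply: special_sub sc => y [fy|[e' [+ e'1 ye']]].
    by left.
  rewrite !finset.in_setU1 => /orP[/eqP e'e|e'S]; last by right; exists e'.
  by left; apply: (@nonfree_fixed e); rewrite // -e'e.
have cell_in g x : enorm x < 1 -> open_cell h (gcw_char e) (h g (@char_ext e x)).
  move=> x1; exists g => //; exists x; last by rewrite char_extE // ltW.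
  by rewrite enorm_open_discE.
have sub_inj g g' x x' : enorm x < 1 -> enorm x' < 1 ->
    h g (@char_ext e x) = h g' (@char_ext e x') -> g = g' /\ x = x'.
  move=> x1 x'1; rewrite !char_extE ?ltW // => E.
  have [||+ ->] := gcw_char_inj _ _ _ _ K _ _ _ _ _ _ _ E; rewrite ?enorm_open_discE //.
  by rewrite e1 !mulg1 => /finset.set1_inj ->.
exists m.+1; apply: (free_cell_step p_pr hX g0_gen g0_ord g0_p (@char_ext_cont e)).
- by move=> x; rewrite /char_ext retr_id // retr_disc.
- exact: subcomplex_closed.
- by move=> g x; apply: subcomplex_act.
- by move=> x; apply: boundary_subcomplex.
- move=> g x x1 [fx|[e' [e'S _ ye']]]; last first.
    by move: eNS; rewrite (gcw_disjoint _ _ _ _ K _ _ _ (cell_in g x x1) ye') e'S.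
  have := fixedptsP fx g0; rewrite -act_mul => /(sub_inj _ _ _ _ x1 x1)[/eqP].
  rewrite -[X in _ == X]mul1g (inj_eq (mulIg g)) => /eqP g01 _.
  by have := g0_ord (prime_gt1 p_pr); rewrite expg1 => /(_ g01).
- exact: sub_inj.
- by move=> x fx; left.
- move=> b c sc; apply: mP; apply: special_sub sc => y [fy|[e' [+ e'1 ye']]].
    by left; left.
  rewrite !finset.in_setU1 => /orP[/eqP e'e|e'S]; last by left; right; exists e'.
  right; move: ye'; rewrite e'e => -[g _ [x x1 <-]].
  rewrite enorm_open_discE in x1.
  by exists g, x; rewrite char_extE // ltW.
Qed.

End Nilpotency.

(** * Direct limits *)

Section Degree.
Variables (R : realType) (A : comNzRingType).

Lemma dd_pull (X Y : topologicalType) (f : continuousType X Y)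
    (c : simplex R Y -> A) s :
  dd (c \o push f) s = dd c (push f s).
Proof.
case: s => -[|k] u //=; apply: eq_bigr => i _; congr (c _ *~ _).
exact: simplex_eq.
Qed.

(** Extension by zero to the other degrees, to pass from cochains of one degree to functions on all
    simplices. *)
Definition homog (X : topologicalType) n (b : cochain R X A n)
    (s : simplex R X) : A :=
  if pselect (exists v : singular_simplex R X n, s = mk_simplex v) is left H
  then b (projT1 (cid H)) else 0.

Lemma homogE (X : topologicalType) n (b : cochain R X A n)
    (v : singular_simplex R X n) : homog b (mk_simplex v) = b v.
Proof.
rewrite /homog; case: pselect => [H|[]]; last by exists v.
by case: cid => w /= e; rewrite (existT_inj2 e).
Qed.

Lemma homog_out (X : topologicalType) n (b : cochain R X A n) k
    (v : singular_simplex R X k) : k <> n -> homog b (mk_simplex v) = 0.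
Proof.
move=> kn; rewrite /homog; case: pselect => // -[w e].
by case: kn; apply: existT_inj1 e.
Qed.

Lemma dd_homog (X : topologicalType) n (b : cochain R X A n)
    (v : singular_simplex R X n.+1) :
  dd (homog b) (mk_simplex v) = coboundary b v.
Proof. by apply: eq_bigr => i _; rewrite homogE. Qed.

Lemma dd_homog0 (X : topologicalType) n (b : cochain R X A n) :
  coboundary b = 0 -> dd (homog b) = (fun=> 0).
Proof.
move=> b0; apply/funext => -[[|k] v] //; have [kn|kn] := pselect (k = n).
  by rewrite kn in v *; rewrite dd_homog b0.
by apply: big1 => i _; rewrite homog_out ?mul0rz.
Qed.

End Degree.

Section ProSpaces.
Variables (R : realType) (I : filtering_category) (X : pro_space I) (p : nat).
Hypothesis p_pr : prime p.
Local Notation Fp := 'F_p.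
Local Notation H k := (pro_cohomology R X Fp k).

Definition pull i j (u : Defs.hom i j) (c : simplex R (X i) -> Fp) :
  simplex R (X j) -> Fp := c \o push (pro_map X u).

Lemma pull_comp i j k (v : Defs.hom j k) (u : Defs.hom i j) c s :
  pull (Defs.comp v u) c s = pull v (pull u c) s.
Proof.
case: s => n w; rewrite /pull /=; congr c; apply: simplex_eq => x /=.
exact: pro_map_comp.
Qed.

Definition pro_class i n (w : cocycles R (X i) Fp n) : H n :=
  @dirlim_in _ (cohomology_system R X Fp n) i (cohomology_class w).

Lemma pro_class_surj n (a : H n) : exists i (w : cocycles R (X i) Fp n),
  a = pro_class w.
Proof.
have [i [x ->]] := dirlim_in_surj a; have [w ->] := cohomology_class_surj x.
by exists i, w.
Qed.

Lemma pro_class_eq n i j (w : cocycles R (X i) Fp n) (w' : cocycles R (X j) Fp n) :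
  pro_class w = pro_class w' <-> exists k (u : Defs.hom i k) (v : Defs.hom j k),
    is_coboundary (pull_cochain (pro_map X u) w - pull_cochain (pro_map X v) w').
Proof.
rewrite /pro_class dirlim_inP; split=> -[k [u [v e]]]; exists k, u, v; move: e.
  by rewrite /= !cohomology_mapE => /cohomology_class_eq /asboolP.
by move=> e; rewrite /= !cohomology_mapE; apply/cohomology_class_eq/asboolP.
Qed.

Lemma pro_class_map n i j (u : Defs.hom i j) (w : cocycles R (X i) Fp n) :
  pro_class (pull_cocycle (pro_map X u) w) = pro_class w.
Proof.
rewrite /pro_class -cohomology_mapE.
exact: (@dirlim_in_map _ (cohomology_system R X Fp n) i j u).
Qed.

Lemma pro_classB n i (w w' : cocycles R (X i) Fp n) :
  pro_class (w - w') = pro_class w - pro_class w'.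
Proof.
have classB : cohomology_class (w - w') = cohomology_class w + - cohomology_class w'.
  exact: (raddfB (\pi_(cohomology R (X i) Fp n))).
rewrite /pro_class classB -[LHS]dirlim_addE -dirlim_oppE.
by [].
Qed.

Lemma pro_class_eq0 n i (w : cocycles R (X i) Fp n) :
  pro_class w = 0 <-> exists k (u : Defs.hom i k),
    is_coboundary (pull_cochain (pro_map X u) w).
Proof.
have e0 : pro_class (0 : cocycles R (X i) Fp n) = 0.
  by rewrite -[X in pro_class X](subrr (0 : cocycles R (X i) Fp n)) pro_classB subrr.
have pull0 k (u v : Defs.hom i k) : pull_cochain (pro_map X u) w -
    pull_cochain (pro_map X v) (0 : cocycles R (X i) Fp n) =
    pull_cochain (pro_map X u) w.
  by apply/funext => s; exact: subr0.
rewrite -[X in _ = X]e0 pro_class_eq; split=> [[k [u [v]]]|[k [u e]]].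
  by rewrite pull0; exists k, u.
by exists k, u, u; rewrite pull0.
Qed.

Lemma const_cocycle_subproof (Y : topologicalType) (l : Fp) :
  (fun=> l : Fp) \in @cocycle R Y Fp 0.
Proof.
apply/cocycleP/funext => s; rewrite /coboundary !big_ord_recl big_ord0 /=.
by rewrite addr0 expr0 expr1 mulr1z mulrN1z subrr.
Qed.

Definition const_cocycle (Y : topologicalType) (l : Fp) : cocycles R Y Fp 0 :=
  Cocycle (const_cocycle_subproof Y l).

Lemma pro_class_const i j (l : Fp) :
  pro_class (const_cocycle (X i) l) = pro_class (const_cocycle (X j) l).
Proof.
have [k [u v]] := upper_bound i j; apply/pro_class_eq; exists k, u, v => /=.
by apply/funext => s; exact: subrr.
Qed.

Lemma cocycle_of_dd (Y : topologicalType) n (a : simplex R Y -> Fp) :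
    (forall s : singular_simplex R Y n.+1, dd a (mk_simplex s) = 0) ->
  exists w : cocycles R Y Fp n, forall s, cocycle_val w s = a (mk_simplex s).
Proof.
move=> a0; have aP : (fun s => a (mk_simplex s)) \in @cocycle R Y Fp n.
  by apply/cocycleP/funext => s; exact: a0.
by exists (Cocycle aP).
Qed.

Lemma acyclic_pos i n (a : simplex R (X i) -> Fp) : (0 < n)%N ->
    (forall a : H n, a = 0) ->
    (forall s : singular_simplex R (X i) n.+1, dd a (mk_simplex s) = 0) ->
  exists j (u : Defs.hom i j) (f : simplex R (X j) -> Fp),
    forall s : singular_simplex R (X j) n, pull u a (mk_simplex s) = dd f (mk_simplex s).
Proof.
move=> n0 H0 a0; have [w wE] := cocycle_of_dd a0.
have /pro_class_eq0[j [u]] := H0 (pro_class w); case: n n0 w wE {H0 a0} => // n _ w wE.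
move=> [b wb]; exists j, u, (homog b) => s; rewrite dd_homog -wb.
exact/esym/wE.
Qed.

Section Acyclic0.
Variable f : {additive H 0 -> Fp}.
Hypothesis f_bij : bijective f.

(** If the constant 1 becomes zero on some [X j], then [X j] has no simplices, and neither has any
    space mapping to it. The limit in degree 0 would vanish, contrary to the bijection with F_p. *)
Lemma pro_one_neq0 i : pro_class (const_cocycle (X i) 1) <> 0.
Proof.
move=> /pro_class_eq0[j [u /= e]].
have noS (s : singular_simplex R (X j) 0) : False.
  by have /eqP := congr1 (fun g => g s) e; rewrite /pull_cochain /= oner_eq0.
have H0 (a : H 0) : a = 0.
  have [k [w ->]] := pro_class_surj a; have [l [v v']] := upper_bound k j.
  rewrite -(pro_class_map v); apply/pro_class_eq0; exists l, (Defs.idm l) => /=.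
  by apply/funext => s; case: (noS (pro_map X v' \o (s : singular_simplex R (X l) 0))).
have [g _ gK] := f_bij; have := gK 1; rewrite (H0 (g 1)) raddf0 => /eqP.
by rewrite eq_sym oner_eq0.
Qed.

Lemma simplex_ex i : exists s : singular_simplex R (X i) 0, True.
Proof.
have [//|nS] := pselect (exists s : singular_simplex R (X i) 0, True).
case: (@pro_one_neq0 i); apply/pro_class_eq0; exists i, (Defs.idm i) => /=.
by apply/funext => s; case: nS; exists s.
Qed.

Lemma acyclic_zero i (a : simplex R (X i) -> Fp) :
    (forall s : singular_simplex R (X i) 1, dd a (mk_simplex s) = 0) ->
  exists j (u : Defs.hom i j) (l : Fp),
    forall s : singular_simplex R (X j) 0, pull u a (mk_simplex s) = l.
Proof.
move=> a0; have [w wE] := cocycle_of_dd a0.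
pose one := pro_class (const_cocycle (X i) 1).
have f1 : f one != 0.
  apply/eqP => f0; apply: (@pro_one_neq0 i); apply: (bij_inj f_bij).
  by rewrite raddf0.
have [l lE] : exists l, l * f one = f (pro_class w).
  by exists (f (pro_class w) / f one); rewrite divfK.
(* [f] is only additive, so multiplication by a scalar of F_p is expressed through natural
   multiples. *)
have constn n : pro_class (const_cocycle (X i) n%:R) = one *+ n.
  elim: n => [|n IH].
    by apply/pro_class_eq0; exists i, (Defs.idm i) => /=; apply/funext => s.
  have : pro_class (const_cocycle (X i) n.+1%:R) -
      pro_class (const_cocycle (X i) n%:R) = one.
    rewrite -pro_classB; congr pro_class; apply: val_inj; apply/funext => s /=.
    by rewrite -[LHS]/(n.+1%:R - n%:R : Fp) mulrS addrK.
  by move=> /eqP; rewrite subr_eq IH => /eqP ->; rewrite -mulrS.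
have : pro_class w = pro_class (const_cocycle (X i) l).
  apply: (bij_inj f_bij); rewrite -[l]natr_Zp constn raddfMn.
  by rewrite -mulr_natr natr_Zp mulrC lE.
move=> /pro_class_eq[j [u [v /= e]]]; exists j, u, l => s.
rewrite /pull /= -wE; apply/eqP; rewrite -subr_eq0; apply/eqP.
by have := congr1 (fun g => g s) e.
Qed.

End Acyclic0.

End ProSpaces.

(** * Smith sequences in the limit and the fixed points *)

Section FixedPoints.
Variables (R : realType) (p : nat) (G : finGroupType) (I : filtering_category).
Variables (X : pro_space I) (h : pro_action G X) (g0 : G).
Hypothesis p_pr : prime p.
Hypothesis g0_gen : forall g : G, exists2 i, (i < p)%N & g = (g0 ^+ i)%g.
Hypothesis g0_p : (g0 ^+ p)%g = 1%g.
Hypothesis X_acyclic : acyclic_mod R X p.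
Local Notation Fp := 'F_p.
Local Notation t i := (gen_act (h i) g0).
Local Notation F i := (fixedpts (t i)).
Local Notation tp i := (@gen_act_p p G (X i) (h i) g0 g0_p).

Lemma push_map_act i j (u : Defs.hom i j) (s : simplex R (X j)) :
  push (pro_map X u) (push (t j) s) = push (t i) (push (pro_map X u) s).
Proof.
by case: s => k w; apply: simplex_eq => x /=; rewrite pro_act_equivariant.
Qed.

Lemma push_map_iter i j (u : Defs.hom i j) n (s : simplex R (X j)) :
  push (pro_map X u) (iter n (push (t j)) s) =
  iter n (push (t i)) (push (pro_map X u) s).
Proof. by elim: n => //= n IH; rewrite push_map_act IH. Qed.

Lemma rho_pull i j (u : Defs.hom i j) b (c : simplex R (X i) -> Fp) s :
  rho (p := p) (push (t j)) b (pull u c) s = pull u (rho (p := p) (push (t i)) b c) s.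
Proof.
rewrite /rho /pull /=; case: b; last by rewrite push_map_act.
by apply: eq_bigr => l _; rewrite push_map_iter.
Qed.

Lemma lies_in_fixed_map i j (u : Defs.hom i j) (s : simplex R (X j)) :
  lies_in (F j) s -> lies_in (F i) (push (pro_map X u) s).
Proof.
move=> /push_fixedP e; apply/push_fixedP.
by rewrite -push_map_act e.
Qed.

Lemma special_pull i j (u : Defs.hom i j) b (c : simplex R (X i) -> Fp) :
  special (p := p) (t i) b (F i) c -> special (p := p) (t j) b (F j) (pull u c).
Proof.
move=> [c0 rc]; split=> s; last by rewrite rho_pull /pull /=.
by move=> sF; apply: c0; apply: lies_in_fixed_map.
Qed.

Lemma rho_degree (Y : topologicalType) (f : continuousType Y Y) b n
    (c c' : simplex R Y -> Fp) :
  (forall v : singular_simplex R Y n, c (mk_simplex v) = c' (mk_simplex v)) ->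
  forall v : singular_simplex R Y n,
    rho (p := p) (push f) b c (mk_simplex v) = rho (p := p) (push f) b c' (mk_simplex v).
Proof.
move=> cc' v; rewrite /rho; case: b; last first.
  by rewrite cc' -[push f _]/(mk_simplex (f \o v)) cc'.
by apply: eq_bigr => l _; have [w -> _] := iter_push f l v.
Qed.

Lemma rho_const (Y : topologicalType) (f : continuousType Y Y) b n
    (c : simplex R Y -> Fp) (l : Fp) :
  (forall v : singular_simplex R Y n, c (mk_simplex v) = l) ->
  forall v : singular_simplex R Y n, rho (p := p) (push f) b c (mk_simplex v) = 0.
Proof.
move=> cl v; rewrite (@rho_degree Y f b n c (fun=> l) cl) /rho; case: b; last by rewrite subrr.
by rewrite sumr_const card_ord -mulr_natl pchar_Fp_0 ?mul0r.
Qed.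

(** Restricted to one degree, because acyclicity of the limit yields a transition map for each
    degree separately. *)
Definition dies i n b (c : simplex R (X i) -> Fp) := exists j (u : Defs.hom i j) e,
  special (p := p) (t j) b (F j) e /\
  forall s : singular_simplex R (X j) n, pull u c (mk_simplex s) = dd e (mk_simplex s).

Lemma special_zero i b : special (R := R) (p := p) (t i) b (F i) (fun=> 0).
Proof.
split=> // s; rewrite /rho; case: b; first exact: big1.
by rewrite subrr.
Qed.

(* In the limit the cochain complex of [X] is acyclic, hence the connecting maps of
   the Smith sequences are injective. *)
Lemma dies_lift i n b (a : simplex R (X i) -> Fp) : dies n.+1 b (dd a) ->
  exists j (u : Defs.hom i j) a',
    [/\ special (p := p) (t j) b (F j) a',
    (0 < n)%N ->
    exists f : simplex R (X j) -> Fp, forall s : singular_simplex R (X j) n,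
      pull u a (mk_simplex s) = dd f (mk_simplex s) + a' (mk_simplex s)
    & n = 0%N -> exists l : Fp, forall s : singular_simplex R (X j) n,
      pull u a (mk_simplex s) = l + a' (mk_simplex s)].
Proof.
move=> [j [u [e [se ue]]]].
pose a' s := pull u a s - e s.
have da' (s : singular_simplex R (X j) n.+1) : dd a' (mk_simplex s) = 0.
  by rewrite (dd_lin (pull u a) (fun s => - e s)) ddN dd_pull -ue subrr.
have [n0|n0] := posnP n.
  have [f f_bij] := X_acyclic.1; rewrite n0 in a' da' *.
  have [k [v [l vl]]] := acyclic_zero f_bij da'.
  exists k, (Defs.comp v u), (pull v e); split => //; first exact: special_pull.
  move=> _; exists l => s; rewrite pull_comp -(vl s) /a' /pull /= subrK.
  by [].
have [k [v [f vf]]] := acyclic_pos n0 (X_acyclic.2 n n0) da'.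
exists k, (Defs.comp v u), (pull v e); split=> [||n00]; first exact: special_pull.
  by move=> _; exists f => s; rewrite pull_comp -vf /a' /pull /= subrK.
by rewrite n00 in n0.
Qed.

(** Here [c] is rho of some [a], and [dd a] dies in the next degree by induction. Then, after a
    transition map, [a] is [dd f] plus a cochain killed by rho, so [c] becomes the coboundary of rho
    of [f], which is special. In degree 0 a constant replaces [dd f], and rho kills constants
    because p = 0 in F_p. *)
Lemma dead_dies m i b c n : dead (R := R) (p := p) (t i) m b c -> dies n b c.
Proof.
elim: m i b c n => [|m IH] i b c n /=.
  move=> [e se ce]; exists i, (Defs.idm i), (pull (Defs.idm i) e).
  split=> [|s]; first exact: special_pull.
  by rewrite dd_pull /pull /= ce.
move=> [a [a0 ca /(IH _ _ _ n.+1)]].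
move=> /dies_lift[j [u [e [[e0 re] Hpos H0]]]].
have cE s : pull u c s = rho (p := p) (push (t j)) (~~ b) (pull u a) s.
  by rewrite rho_pull /pull /= ca.
have [n0|n0] := posnP n.
  have [l al] := H0 n0; exists j, u, (fun=> 0); split; first exact: special_zero.
  move=> s; rewrite cE dd0 (@rho_degree _ (t j) _ _ _ (fun s => l + e s) al).
  rewrite (rhoD (t j) _ (fun=> l) e) re addr0.
  exact: (@rho_const _ _ _ n _ l).
have [f af] := Hpos n0; exists j, u, (rho (p := p) (push (t j)) (~~ b) f); split.
  split=> s; last exact: (rho_rho (iter_push_p (tp j))).
  by move=> /push_fixedP; apply: rho_fixed.
move=> s; rewrite cE (@rho_degree _ (t j) _ _ _ (fun s => dd f s + e s) af).
  by rewrite rhoD re addr0 dd_rho.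
Qed.

Hypothesis nilp : forall i, exists m, forall b c,
  special (R := R) (p := p) (t i) b (F i) c -> dd c = (fun=> 0) ->
  dead (p := p) (t i) m b c.

Lemma special_dies i b c n : special (R := R) (p := p) (t i) b (F i) c ->
  dd c = (fun=> 0) -> dies n b c.
Proof.
have [m mP] := nilp i => sc dc; exact: dead_dies (mP b c sc dc).
Qed.

(** Without fixed points the constant 1 in degree 0 would be a special cocycle. It would die, that
    is, become 0 on some [X j], as coboundaries vanish in degree 0; but [X j] has a simplex. *)
Lemma fixed_nonempty i : exists x, F i x.
Proof.
have [//|nF] := pselect (exists x, F i x); exfalso.
pose one := @homog R Fp (X i) 0 (fun=> 1).
have one1 (s : singular_simplex R (X i) 0) : one (mk_simplex s) = 1 by rewrite /one homogE.
have sone : special (p := p) (t i) false (F i) one.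
  split=> [s|[k s]].
    by move=> /lies_in_nonempty[x Fx]; case: nF; exists x.
  have [k0|k0] := pselect (k = 0%N).
    by rewrite k0 in s *; apply: (@rho_const _ _ _ 0 _ 1 one1).
  apply: (@rho_const _ _ _ k _ 0) => v; exact: homog_out.
have dd_one : dd one = (fun=> 0) by apply: dd_homog0; apply/cocycleP; apply: const_cocycle_subproof.
have [j [u [e [_ ue]]]] := special_dies 0 sone dd_one.
have [f f_bij] := X_acyclic.1; have [s _] := simplex_ex f_bij j.
have e1 : one (mk_simplex (pro_map X u \o s)) = 0 := ue s.
by have /eqP := oner_neq0 Fp; apply; rewrite -(one1 (pro_map X u \o s)).
Qed.

Local Notation Z i := (fixed_points (h i)).

Lemma fixed_incl_continuous i : continuous (set_val : Z i -> X i).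
Proof. exact: initial_continuous. Qed.

Definition fixed_incl i : continuousType (Z i) (X i) :=
  mkcts (@fixed_incl_continuous i).

Lemma lies_in_fixed i (v : simplex R (Z i)) : lies_in (F i) (push (fixed_incl i) v).
Proof. by case: v => k v x; apply: (set_mem (valP ((v : singular_simplex R (Z i) k) x))). Qed.

Lemma fixed_lift i (s : simplex R (X i)) : lies_in (F i) s ->
  exists v : simplex R (Z i), s = push (fixed_incl i) v.
Proof.
case: s => k s sF.
have sZ x : (s : singular_simplex R (X i) k) x \in Z i.
  by apply: mem_set => g; apply: (fixedptsP g0_gen); apply: sF.
pose v x : Z i := exist (fun y => y \in Z i) _ (sZ x).
have cv : continuous v by apply: continuous_comp_initial => x; apply: cts_fun.
by exists (@mk_simplex R (Z i) k (mkcts cv)); apply: simplex_eq.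
Qed.

Lemma fixed_incl_inj i : injective (push (R := R) (fixed_incl i)).
Proof.
move=> [k v] [k' v'] e; have kk := existT_inj1 e; case: _ / kk v' e => v' e.
apply: simplex_eq => x; apply: val_inj.
by have := existT_inj2 e => /(congr1 (fun w : singular_simplex R (X i) k => w x)).
Qed.

Definition extend_zero i (w : simplex R (Z i) -> Fp) (s : simplex R (X i)) : Fp :=
  if pselect (exists v, s = push (fixed_incl i) v) is left H
  then w (projT1 (cid H)) else 0.

Lemma extend_zeroE i w v : @extend_zero i w (push (fixed_incl i) v) = w v.
Proof.
rewrite /extend_zero; case: pselect => [H|[]]; last by exists v.
by case: cid => v' /= /fixed_incl_inj ->.
Qed.

(** The component of the connecting map on the cohomology of the fixed points. Extension by zero is
    invariant under t, and on fixed simplices its coboundary is that of [w]. *)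
Lemma extend_zero_special i w : dd w = (fun=> 0) ->
  special (p := p) (t i) false (F i) (dd (@extend_zero i w)).
Proof.
move=> dw; split=> s.
  move=> /fixed_lift[v ->]; rewrite -dd_pull.
  have -> : extend_zero w \o push (fixed_incl i) = w.
    by apply/funext => v'; rewrite /= extend_zeroE.
  by rewrite dw.
rewrite -dd_rho (_ : rho (p := p) _ _ _ = fun=> 0) ?dd0 //.
apply/funext => {}s; have [fs|nF] := pselect (push (t i) s = s).
  exact: rho_fixed.
have ez s' : push (t i) s' <> s' -> extend_zero w s' = 0.
  move=> nF'; rewrite /extend_zero; case: pselect => // -[v e]; case: nF'.
  by apply/push_fixedP; rewrite e; apply: lies_in_fixed.
(* If the translate of [s] were fixed, applying t^(p-1) would show that [s] is fixed. *)
rewrite /rho !ez ?subrr // => /(congr1 (iter p.-1 (push (t i)))).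
rewrite -!iterSr prednK ?prime_gt0 // => e; apply: nF.
rewrite -{2}[s](iter_push_p (tp i)) -e iterSr.
by rewrite (iter_push_p (tp i)).
Qed.

Lemma push_fixed_map i j (u : Defs.hom i j) (v : simplex R (Z j)) :
  push (pro_map X u) (push (fixed_incl j) v) =
  push (fixed_incl i) (push (fixed_map h u) v).
Proof. by case: v => k v; apply: simplex_eq. Qed.

(** The coboundary of the extension by zero dies, so after a transition map the extension is a
    coboundary, or a constant in degree 0, plus a special cochain. Restriction to the fixed
    simplices removes the latter. *)
Lemma fixed_cocycle i n (w : simplex R (Z i) -> Fp) : dd w = (fun=> 0) ->
  exists j (u : Defs.hom i j),
    ((0 < n)%N -> exists f : simplex R (Z j) -> Fp,
      forall s : singular_simplex R (Z j) n,
        w (push (fixed_map h u) (mk_simplex s)) = dd f (mk_simplex s)) /\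
    (n = 0%N -> exists l : Fp, forall s : singular_simplex R (Z j) n,
        w (push (fixed_map h u) (mk_simplex s)) = l).
Proof.
move=> dw; have sa := extend_zero_special dw.
have [j [u [a' [[a'0 _] Hpos H0]]]] := dies_lift (special_dies n.+1 sa (dd_dd _)).
exists j, u; have wE (s : singular_simplex R (Z j) n) :
    w (push (fixed_map h u) (mk_simplex s)) =
    pull u (extend_zero w) (push (fixed_incl j) (mk_simplex s)).
  rewrite -[RHS]/(extend_zero w (push (pro_map X u)
    (push (fixed_incl j) (mk_simplex s)))).
  by rewrite push_fixed_map extend_zeroE.
split=> n0.
  have [f fE] := Hpos n0; exists (f \o push (fixed_incl j)) => s.
  rewrite wE -[push _ _]/(mk_simplex (fixed_incl j \o s)) fE dd_pull a'0 ?addr0 //.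
  exact: (lies_in_fixed (mk_simplex s)).
have [l lE] := H0 n0; exists l => s.
rewrite wE -[push _ _]/(mk_simplex (fixed_incl j \o s)) lE a'0 ?addr0 //.
exact: (lies_in_fixed (mk_simplex s)).
Qed.

(** In degree 0 every class is a constant, and a fixed point in each [X j] tells the constants
    apart. The isomorphism with F_p is the inverse of the class map of constants. *)
Lemma fixed_acyclic : acyclic_mod R (fixed_pro h) p.
Proof.
have classE n i (w : cocycles R (Z i) Fp n) : exists w' : simplex R (Z i) -> Fp,
    dd w' = (fun=> 0) /\ forall s, w' (mk_simplex s) = cocycle_val w s.
  exists (homog (cocycle_val w)); split; last by move=> s; rewrite homogE.
  by apply: dd_homog0; apply/cocycleP/(valP w).
have const_class (a : pro_cohomology R (fixed_pro h) Fp 0) :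
    exists i l, a = pro_class (const_cocycle R (fixed_pro h i) l).
  have [i [w ->]] := pro_class_surj a; have [w' [dw' w'E]] := classE _ _ w.
  have [j [u [_ /(_ erefl)[l lE]]]] := fixed_cocycle 0 dw'.
  exists i, l; apply/pro_class_eq; exists j, u, u; apply/funext => s.
  have := lE s; rewrite -[push _ _]/(mk_simplex (fixed_map h u \o s)) w'E => e.
  exact: etrans (congr1 (fun z => z - l) e) (subrr l).
split; last first.
  move=> n n0 a; have [i [w ->]] := pro_class_surj a; have [w' [dw' w'E]] := classE _ _ w.
  have [j [u [/(_ n0)[f fE] _]]] := fixed_cocycle n dw'.
  apply/pro_class_eq0; exists j, u; case: n n0 w w'E fE {a} => // n _ w w'E fE.
  exists (fun s => f (mk_simplex s)); apply/funext => s.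
  by have := fE s; rewrite -[push _ _]/(mk_simplex (fixed_map h u \o s)) w'E.
have [i0 _ _] := filteringP I; case: i0 => i0.
pose cls (l : Fp) := pro_class (const_cocycle R (fixed_pro h i0) l).
have clsB l l' : cls (l - l') = cls l - cls l'.
  by rewrite -pro_classB; congr pro_class; apply: val_inj.
have cls_inj l l' : cls l = cls l' -> l = l'.
  move=> /pro_class_eq[j [u [v /= e]]]; have [x Fx] := fixed_nonempty j.
  have Zx : x \in Z j by apply: mem_set => g; apply: (fixedptsP g0_gen).
  pose x' : Z j := exist (fun y => y \in Z j) x Zx.
  have cx : continuous (fun _ : std_simplex R 0 => x') by exact: cst_continuous.
  pose sx : singular_simplex R (Z j) 0 := mkcts cx.
  have e1 : l - l' = 0 := congr1 (fun g : singular_simplex R (Z j) 0 -> Fp => g sx) e.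
  by move/eqP: e1; rewrite subr_eq0 => /eqP.
have cls_surj a : exists l, a = cls l.
  by have [i [l ->]] := const_class a; exists l; apply: pro_class_const.
have /choice[g gK] := cls_surj.
have gB : zmod_morphism g.
  by move=> a b; apply: cls_inj; rewrite clsB -!gK.
pose gA := GRing.isZmodMorphism.Build _ _ g gB.
pose g_add : {additive pro_cohomology R (fixed_pro h) Fp 0 -> Fp} := HB.pack g gA.
exists g_add; exists cls => a; first by rewrite -gK.
by apply: cls_inj; rewrite -gK.
Qed.

End FixedPoints.

Theorem theorem4p5 (R : realType) (p : nat) (G : finGroupType)
    (I : filtering_category) (X : pro_space I) (h : pro_action G X)
    (K : forall i : I, finite_GCW R (h i)) (N : nat) :
  prime p ->
  #|G| = p ->
  acyclic_mod R X p ->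
  (forall (i : I) (e : gcw_cell (K i)), (gcw_dim e <= N)%N) ->
  acyclic_mod R (fixed_pro h) p.
Proof.
move=> p_pr Gp X_acyclic _.
have pG : prime #|[set: G]%SET| by rewrite cardsT Gp.
have [g0 Gg0] := cyclicP (prime_cyclic pG).
have og0 : #[g0]%g = p by rewrite orderE -Gg0 cardsT.
have g0_gen (g : G) : exists2 i, (i < p)%N & g = (g0 ^+ i)%g.
  have /cyclePmin[i] : g \in <[g0]>%g by rewrite -Gg0 finset.in_setT.
  by rewrite og0; exists i.
have g0_ord i : (i < p)%N -> (g0 ^+ i)%g = 1%g -> i = 0%N.
  move=> ip /eqP; rewrite -order_dvdn og0 => /dvdn_leq.
  by case: i ip => // i ip /(_ isT); rewrite leqNgt ip.
have g0_p : (g0 ^+ p)%g = 1%g by rewrite -og0 expg_order.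
apply: (fixed_acyclic p_pr g0_gen g0_p X_acyclic) => i.
exact: (gcw_nilpotent (K i) p_pr Gp (@pro_hausdorff I X i) g0_gen g0_ord g0_p).
Qed.
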